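(* For any $d\ge1$ and $\alpha>0$, there exist constants $c=c(d,\alpha)>0$ and $L=L(d,\alpha)$ such that, for every sample size $n\geq 1$, $$\inf_{\hat s}\ \sup_{\rho^\ast\in\mathcal{P}_{\alpha,L}}\mathbb{E}\,\ell(\hat s,\rho^\ast)\ \ge\ c(d,\alpha)\,n^{-\frac{2}{d+4}},$$ where the infimum is over all score estimators $\hat s(\cdot)=\hat s(\cdot;X_1,\dots,X_n)$ measurable with respect to the sample, and the expectation is over $(X_1,\dots,X_n)\sim(\rho^\ast)^{\otimes n}$.
   Context: A probability distribution $\rho$ on $\mathbb{R}^d$ is $\alpha$-subgaussian ($0<\alpha<\infty$) if $\mathbb{E}_{\rho}\exp(\theta^\top(X-\mathbb{E}_\rho X))\le\exp(\alpha^2\|\theta\|^2/2)$ for all $\theta\in\mathbb{R}^d$. $\mathcal{P}_{\alpha,L}$ is the class of probability distributions on $\mathbb{R}^d$ with full support that have a density (also denoted $\rho$), are $\alpha$-subgaussian, and whose score function $s=\nabla\log\rho:\mathbb{R}^d\to\mathbb{R}^d$ is $L$-Lipschitz (with $\alpha^2L\ge1$, so that the class is nonempty). The loss is $\ell(\hat s,\rho^\ast)=\int_{\mathbb{R}^d}\|\hat s(x)-\nabla\log\rho^\ast(x)\|^2\rho^\ast(x)\,dx$. *)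

(* Defs.v *)
From HB Require Import structures.
From mathcomp Require Import all_boot all_order all_algebra.
From mathcomp Require Import all_classical all_reals all_analysis.

Set Implicit Arguments.
Unset Strict Implicit.
Unset Printing Implicit Defensive.
Import Order.TTheory GRing.Theory Num.Theory.
Import numFieldNormedType.Exports.
Local Open Scope classical_set_scope.
Local Open Scope ring_scope.

Definition measure_row_display : measure_display -> measure_display.
Proof. exact. Qed.

Section measurable_row.
Context {d : measure_display} {T : measurableType d}.
Variable n : nat.

Let coors : 'I_n -> 'rV[T]_n -> T := fun i x => x ord0 i.

Let row_set0 : g_sigma_preimage coors set0.
Proof. exact: sigma_algebra0. Qed.

Let row_setC A : g_sigma_preimage coors A -> g_sigma_preimage coors (~` A).
Proof. exact: sigma_algebraC. Qed.

Let row_bigcup (F : (set 'rV[T]_n)^nat) :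
  (forall i, g_sigma_preimage coors (F i)) ->
  g_sigma_preimage coors (\bigcup_i (F i)).
Proof. exact: sigma_algebra_bigcup. Qed.

(* The product sigma-algebra, generated by the coordinate maps; for the real
   numbers it is the Borel sigma-algebra. *)
HB.instance Definition _ := @isMeasurable.Build (measure_row_display d)
  ('rV[T]_n) (g_sigma_preimage coors) row_set0 row_setC row_bigcup.

End measurable_row.

Definition row_of_tuple (T : Type) (n : nat) (t : n.-tuple T) : 'rV[T]_n :=
  \row_i tnth t i.

Lemma measurable_row_coord d (T : measurableType d) n (i : 'I_n) :
  measurable_fun [set: 'rV[T]_n] (fun x : 'rV[T]_n => x ord0 i).
Proof.
move=> _ Y mY; rewrite setTI; apply: sub_sigma_algebra => /=.
rewrite -bigcup_seq/=; exists i => /=; first by rewrite mem_index_enum.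
by exists Y => //; rewrite setTI.
Qed.

Lemma measurable_fun_rowP d1 d2 (T1 : measurableType d1)
    (T2 : measurableType d2) n (f : T1 -> 'rV[T2]_n) :
  measurable_fun [set: T1] f <->
  forall i, measurable_fun [set: T1] (fun t => f t ord0 i).
Proof.
split=> [mf i|mf].
  exact: (measurableT_comp (@measurable_row_coord d2 T2 n i) mf).
move=> _ Y mY; rewrite setTI.
suff sub : g_sigma_preimage ((fun i => (fun x : 'rV[T2]_n => x ord0 i) \o f))
    `<=` measurable.
  by apply: sub; rewrite g_sigma_preimage_comp; exists Y => //; rewrite setTI.
apply: smallest_sub; first exact: sigma_algebra_measurable.
move=> A; rewrite -bigcup_seq => -[i _ [B mB <-]].
exact: mf.
Qed.

Section sigma_finite_lemmas.
Local Open Scope ereal_scope.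
Context {d1 d2 : measure_display} {T1 : measurableType d1}
  {T2 : measurableType d2} {R : realType}.

Lemma pushforward_sigma_finite (m : set T1 -> \bar R)
    (f : T1 -> T2) (g : T2 -> T1) :
  cancel f g -> measurable_fun setT g ->
  sigma_finite setT m -> sigma_finite setT (pushforward m f).
Proof.
move=> fK mg [F TF Foo].
exists (fun k => g @^-1` F k); first by rewrite -preimage_bigcup -TF.
move=> k; have [mF mFoo] := Foo k; split.
  by rewrite -[X in measurable X]setTI; exact: mg.
rewrite /pushforward (_ : f @^-1` (g @^-1` F k) = F k)//.
by apply/funext => x /=; rewrite fK.
Qed.

(* The library only infers sigma-finiteness of a product of two measures when
   they are subprobabilities. *)
Lemma product_sigma_finite (m1 : {sigma_finite_measure set T1 -> \bar R})
    (m2 : {sigma_finite_measure set T2 -> \bar R}) :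
  sigma_finite setT (m1 \x m2).
Proof.
have /sigma_finiteP[F [TF ndF Foo]] := sigma_finiteT m1.
have /sigma_finiteP[G [TG ndG Goo]] := sigma_finiteT m2.
exists (fun k => F k `*` G k).
  rewrite -setXTT TF TG predeqE => -[x y]; split.
    move=> [/= [i _ Fix] [j _ Gjy]]; exists (maxn i j) => //; split.
    - by move: x Fix; exact/subsetPset/ndF/leq_maxl.
    - by move: y Gjy; exact/subsetPset/ndG/leq_maxr.
  by move=> [i _ []/= ? ?]; split; exists i.
move=> k; have [? ?] := Foo k; have [? ?] := Goo k.
split; first exact: measurableX.
by rewrite product_measure1E// lte_mul_pinfty// ge0_fin_numE.
Qed.

End sigma_finite_lemmas.

Definition tuple_cons (T : Type) (n : nat) (p : T * n.-tuple T) :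
  n.+1.-tuple T := [tuple of p.1 :: p.2].

Lemma measurable_tuple_cons d (T : measurableType d) n :
  measurable_fun [set: T * n.-tuple T] (@tuple_cons T n).
Proof. exact: measurable_cons. Qed.

Definition tuple_uncons (T : Type) (n : nat) (t : n.+1.-tuple T) :
  T * n.-tuple T := (thead t, [tuple of behead t]).

Lemma measurable_tuple_uncons d (T : measurableType d) n :
  measurable_fun [set: n.+1.-tuple T] (@tuple_uncons T n).
Proof.
apply: measurable_fun_pair; last exact: measurable_behead.
exact: measurable_tnth.
Qed.

Lemma tuple_consK (T : Type) n : cancel (@tuple_cons T n) (@tuple_uncons T n).
Proof. by case=> x t; congr pair; apply: val_inj. Qed.

Section cons_measure.
Local Open Scope ereal_scope.
Context {d : measure_display} {T : measurableType d} {R : realType} {n : nat}.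
Variables (m1 : {sigma_finite_measure set T -> \bar R})
  (m2 : {sigma_finite_measure set (n.-tuple T) -> \bar R}).

Definition cons_measure : set (n.+1.-tuple T) -> \bar R :=
  pushforward (m1 \x m2) (@tuple_cons T n).

Let cons_measure0 : cons_measure set0 = 0.
Proof. by rewrite /cons_measure measure0//; exact: measurable_tuple_cons. Qed.

Let cons_measure_ge0 A : 0 <= cons_measure A.
Proof.
by rewrite /cons_measure measure_ge0//; exact: measurable_tuple_cons.
Qed.

Let cons_measure_sigma_additive : semi_sigma_additive cons_measure.
Proof.
apply: measure_semi_sigma_additive; exact: measurable_tuple_cons.
Qed.

HB.instance Definition _ := isMeasure.Build _ _ _ cons_measure
  cons_measure0 cons_measure_ge0 cons_measure_sigma_additive.

Let cons_measure_sigma_finite : sigma_finite setT cons_measure.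
Proof.
apply: (@pushforward_sigma_finite _ _ _ _ _ (m1 \x m2) _ _ (@tuple_consK T n)).
  exact: measurable_tuple_uncons.
exact: product_sigma_finite.
Qed.

HB.instance Definition _ := @Measure_isSigmaFinite.Build _ _ _ cons_measure
  cons_measure_sigma_finite.

End cons_measure.

Fixpoint power_measure d (T : measurableType d) (R : realType)
    (m : {sigma_finite_measure set T -> \bar R}) (n : nat) :
    {sigma_finite_measure set (n.-tuple T) -> \bar R} :=
  match n with
  | 0 => \d_([tuple] : 0.-tuple T)
  | k.+1 => cons_measure m (power_measure m k)
  end.

Lemma power_measure_box d (T : measurableType d) (R : realType)
    (m : {sigma_finite_measure set T -> \bar R}) (n : nat)
    (A : 'I_n -> set T) : (forall i, measurable (A i)) ->
  power_measure m n [set t | forall i, A i (tnth t i)] =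
  (\prod_(i < n) m (A i))%E.
Proof.
elim: n A => [|n IH] A mA.
  rewrite big_ord0 /= diracE mem_set//= => -[].
  by [].
rewrite big_ord_recl -IH//= /cons_measure /pushforward.
have -> : @tuple_cons T n @^-1` [set t | forall i, A i (tnth t i)] =
    A ord0 `*` [set t | forall i, A (lift ord0 i) (tnth t i)].
  apply/seteqP; split => [[x t] /= h|[x t] /= [h0 h] i].
    by split => [|i]; [have := h ord0|have := h (lift ord0 i); rewrite tnthS].
  have [j ->|->] := unliftP ord0 i; last exact: h0.
  by rewrite tnthS; exact: h.
rewrite product_measure1E//.
rewrite (_ : mkset _ = \bigcap_(i in [set: 'I_n])
    ((fun t : n.-tuple T => tnth t i) @^-1` A (lift ord0 i))); last first.
  by apply/seteqP; split => [t h i _|t h i]; [exact: h|exact: (h i)].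
apply: fin_bigcap_measurable => // i _.
by rewrite -[X in measurable X]setTI; exact: measurable_tnth.
Qed.

Definition tuple_of_row (T : Type) (n : nat) (x : 'rV[T]_n) : n.-tuple T :=
  [tuple x ord0 i | i < n].

Lemma row_of_tupleK (T : Type) n :
  cancel (@row_of_tuple T n) (@tuple_of_row T n).
Proof.
by move=> t; apply: eq_from_tnth => i; rewrite tnth_mktuple mxE.
Qed.

Section lebesgue_row.
Local Open Scope ereal_scope.
Context {R : realType} {d : nat}.

(* [measurableTypeR R] is [R] with its Borel sigma-algebra under the display
   expected by [lebesgue_measure]. *)
Let Rm : measurableType _ := measurableTypeR R.

Let measurable_row_of_tupleR :
  measurable_fun [set: d.-tuple Rm] (@row_of_tuple R d).
Proof.
apply/measurable_fun_rowP => i _ Y mY.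
rewrite (_ : (fun t => _) = fun t : d.-tuple Rm => tnth t i).
  exact: (@measurable_tnth _ Rm).
by apply/funext => t; rewrite mxE.
Qed.

Let measurable_tuple_of_rowR :
  measurable_fun [set: 'rV[R]_d] (@tuple_of_row R d : _ -> d.-tuple Rm).
Proof.
apply/measurable_fun_tnthP => i _ Y mY.
rewrite (_ : _ \o _ = fun x : 'rV[R]_d => x ord0 i).
  exact: measurable_row_coord.
by apply/funext => x /=; rewrite tnth_mktuple.
Qed.

Definition lebesgue_row : set 'rV[R]_d -> \bar R :=
  pushforward
    (power_measure (@lebesgue_measure R) d : set (d.-tuple Rm) -> \bar R)
    (@row_of_tuple R d).

Let lebesgue_row0 : lebesgue_row set0 = 0.
Proof. by rewrite /lebesgue_row measure0//; exact: measurable_row_of_tupleR. Qed.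

Let lebesgue_row_ge0 A : 0 <= lebesgue_row A.
Proof.
by rewrite /lebesgue_row measure_ge0//; exact: measurable_row_of_tupleR.
Qed.

Let lebesgue_row_sigma_additive : semi_sigma_additive lebesgue_row.
Proof.
apply: measure_semi_sigma_additive; exact: measurable_row_of_tupleR.
Qed.

HB.instance Definition _ := isMeasure.Build _ _ _ lebesgue_row
  lebesgue_row0 lebesgue_row_ge0 lebesgue_row_sigma_additive.

Let lebesgue_row_sigma_finite : sigma_finite setT lebesgue_row.
Proof.
apply: (@pushforward_sigma_finite _ _ _ _ _
  (power_measure (@lebesgue_measure R) d) _ _ (@row_of_tupleK Rm d)).
- exact: measurable_tuple_of_rowR.
- exact: sigma_finiteT.
Qed.

HB.instance Definition _ := @Measure_isSigmaFinite.Build _ _ _ lebesgue_row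
  lebesgue_row_sigma_finite.

Lemma lebesgue_row_box (A : 'I_d -> set R) : (forall i, measurable (A i)) ->
  lebesgue_row [set x | forall i, A i (x ord0 i)] =
  \prod_(i < d) lebesgue_measure (A i).
Proof.
move=> mA; rewrite -[RHS]power_measure_box// /lebesgue_row /pushforward.
by congr (power_measure _ _ _); apply/funext => t /=;
  apply/propext; split => h i; have := h i; rewrite mxE.
Qed.

End lebesgue_row.

Section score_estimation.
Context {R : realType} {d : nat}.
Implicit Types (P : probability 'rV[R]_d R) (x y u v : 'rV[R]_d).

(* The library norm on row vectors is the sup norm. *)
Definition dotr u v : R := \sum_(i < d) u ord0 i * v ord0 i.
Definition enorm u : R := Num.sqrt (dotr u u).

Definition gradient (g : 'rV[R]_d -> R) x : 'rV[R]_d :=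
  \row_i 'D_(delta_mx ord0 i) g x.

Definition score (rho : 'rV[R]_d -> R) : 'rV[R]_d -> 'rV[R]_d :=
  gradient (fun x => ln (rho x)).

Definition elipschitz (L : R) (g : 'rV[R]_d -> 'rV[R]_d) : Prop :=
  forall x y, enorm (g x - g y) <= L * enorm (x - y).

Definition full_support P : Prop :=
  forall U : set 'rV[R]_d, open U -> U !=set0 -> (0 < P U)%E.

Definition is_density P (rho : 'rV[R]_d -> R) : Prop :=
  [/\ measurable_fun setT rho, (forall x, 0 <= rho x) &
    forall A, measurable A -> P A = (\int[lebesgue_row]_(x in A) (rho x)%:E)%E].

Definition mean P : 'rV[R]_d := \row_i fine 'E_P[fun x => x ord0 i].

Definition subgaussian (alpha : R) P : Prop :=
  (forall i, P.-integrable setT (fun x => (x ord0 i)%:E)) /\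
  forall theta : 'rV[R]_d,
    ('E_P[fun x => expR (dotr theta (x - mean P))] <=
     (expR (alpha ^+ 2 * enorm theta ^+ 2 / 2))%:E)%E.

(* Positivity of the density and differentiability of its logarithm make the
   score, defined through partial derivatives, the actual gradient at every
   point. Both determine [rho] uniquely from [P], so that ranging over such
   pairs amounts to ranging over distributions. *)
Record score_class (alpha L : R) P (rho : 'rV[R]_d -> R) : Prop := {
  score_class_support : full_support P;
  score_class_density : is_density P rho;
  score_class_subgaussian : subgaussian alpha P;
  score_class_gt0 : forall x, 0 < rho x;
  score_class_diff : forall x, differentiable (fun y => ln (rho y)) x;
  score_class_lipschitz : elipschitz L (score rho)
}.

Definition score_loss (s : 'rV[R]_d -> 'rV[R]_d) (rho : 'rV[R]_d -> R) :
    \bar R :=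
  (\int[lebesgue_row]_x (enorm (s x - score rho x) ^+ 2 * rho x)%:E)%E.

(* [s (X, x)] is the value at [x] of the estimator built from the sample [X]. *)
Definition score_risk (n : nat) (s : n.-tuple 'rV[R]_d * 'rV[R]_d -> 'rV[R]_d)
    P (rho : 'rV[R]_d -> R) : \bar R :=
  (\int[power_measure P n]_X score_loss (fun x => s (X, x)) rho)%E.

(* Estimators are jointly measurable in the sample and the evaluation point. *)
Definition minimax_score_risk (alpha L : R) (n : nat) : \bar R :=
  ereal_inf [set ereal_sup [set score_risk s rho.1 rho.2
      | rho in [set rho : probability 'rV[R]_d R * ('rV[R]_d -> R)
                 | score_class alpha L rho.1 rho.2]]
    | s in [set s : n.-tuple 'rV[R]_d * 'rV[R]_d -> 'rV[R]_d
             | measurable_fun setT s]].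

End score_estimation.

(* Main.v *)
Require Import Defs.
From HB Require Import structures.
From mathcomp Require Import all_boot all_order all_algebra.
From mathcomp Require Import all_classical all_reals all_analysis.
From mathcomp Require Import measurable_realfun ring lra.
Import Order.TTheory GRing.Theory Num.Theory.
Import numFieldNormedType.Exports.
Local Open Scope classical_set_scope.
Local Open Scope ring_scope.
Set Implicit Arguments.
Unset Strict Implicit.
Unset Printing Implicit Defensive.

(* Assouad's lemma around the Gaussian N(0, sigma^2 I) with 2 sigma^2 = alpha^2.
   The unit cube is cut into m^d cells of side h = 1/m, with m ~ n^(1/(d+4)). In
   each cell sit d+2 disjoint bumps max(0, r^2 - |x - z|^2)^2 with r ~ h; some
   combination of them, with coefficients bounded by 1 and one coefficient equal
   to 1, is orthogonal to 1 and to all coordinates in L^2 of the Gaussian.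
   Multiplying the Gaussian density by 1 + (these combinations, at height of order
   h^2 and with a free sign per cell) therefore preserves mass and mean, and keeps
   it below twice the Gaussian, which suffices for alpha-subgaussianity; the
   scores stay uniformly Lipschitz because the bumps are C^{1,1} and disjoint.
   Flipping one sign changes the score by order h on a set of volume of order
   h^d, while the chi-square divergence is of order h^(4+d) <= 1/n, so the n-fold
   products cannot be told apart. Summing over the h^(-d) cells gives a risk of
   order h^2. *)

(** * Product measures and densities *)

(** Both orthogonality conditions are imposed cell by cell. If the mass were restored by
    renormalising, the density would depend on all signs at once and a flip would be felt
    everywhere; exact cancellation inside each cell keeps the flip local. The mean has to be exact
    too, because the moment generating function is compared with the Gaussian one only after the
    linear term is removed. These are d+1 linear conditions, hence d+2 bumps. Their coefficients
    come from a kernel vector that is not explicit, so errors are counted only near the bump whose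
    coefficient is 1, and on a box off its centre, since the gradient of a bump vanishes at the
    centre. The base variance alpha^2/2 leaves the room that the factor two between the densities
    costs. A bump of radius r is scaled to height eps r^2: its gradient is then of order eps r and
    the Lipschitz constant of that gradient of order eps, so L does not depend on n. The constant
    eps is chosen so that the chi-square divergence of one flip is at most 1/(2n). *)

Section measure_density.
Local Open Scope ereal_scope.
Context {d : measure_display} {T : measurableType d} {R : realType}.

(** Reduces to the change of variables for the Radon-Nikodym derivative of [nu], which agrees with
    [g] almost everywhere because both have integral [nu A] over every measurable [A]. *)
Lemma ge0_integral_density (nu : {finite_measure set T -> \bar R})
    (mu : {sigma_finite_measure set T -> \bar R}) (g : T -> R)
    (f : T -> \bar R) :
  measurable_fun setT g -> (forall x, (0 <= g x)%R) ->
  (forall A, measurable A -> nu A = \int[mu]_(x in A) (g x)%:E) ->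
  measurable_fun setT f -> (forall x, 0 <= f x) ->
  \int[nu]_x f x = \int[mu]_x (f x * (g x)%:E).
Proof.
move=> mg g0 nuE mf f0.
have numu : nu `<< mu.
  apply/null_content_dominatesP => A mA A0; rewrite nuE//.
  apply: null_set_integral => //.
  by apply: measurable_funTS; exact/measurable_EFinP.
rewrite -(Radon_Nikodym_SigmaFinite.change_of_variables numu)//.
have mRN := Radon_Nikodym_SigmaFinite.f_integrable numu.
have RN0 := Radon_Nikodym_SigmaFinite.f_ge0 numu.
have mh : measurable_fun setT (Radon_Nikodym_SigmaFinite.f nu mu).
  exact: measurable_int mRN.
apply: ge0_ae_eq_integral => //.
- exact: emeasurable_funM.
- by apply: emeasurable_funM => //; exact/measurable_EFinP.
- by move=> x _; rewrite mule_ge0.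
- by move=> x _; rewrite mule_ge0// lee_fin.
- apply: ae_eqe_mul2l; apply: integral_ae_eq => //.
    exact/measurable_EFinP.
  move=> A _ mA.
  by rewrite -(Radon_Nikodym_SigmaFinite.f_integral numu)// nuE.
Qed.

Lemma ge0_integral_power_measureS (m : {sigma_finite_measure set T -> \bar R})
    n (F : n.+1.-tuple T -> \bar R) :
  measurable_fun setT F -> (forall t, 0 <= F t) ->
  \int[power_measure m n.+1]_t F t =
  \int[m]_x \int[power_measure m n]_t F (tuple_cons (x, t)).
Proof.
move=> mF F0 /=.
have mc := @measurable_tuple_cons _ T n.
rewrite /cons_measure (ge0_integral_pushforward mc)//.
rewrite preimage_setT fubini_tonelli1//=.
exact: measurableT_comp mF mc.
Qed.

Lemma measurable_prod_tnth n (g : 'I_n -> T -> R) :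
  (forall i, measurable_fun setT (g i)) ->
  measurable_fun setT (fun t : n.-tuple T => (\prod_(i < n) g i (tnth t i))%R).
Proof.
move=> mg; apply: measurable_prod => i _.
by apply: measurableT_comp => //; exact: measurable_tnth.
Qed.

(** Induction on [n] for arbitrary nonnegative [F]: Tonelli splits off the first sample point, the
    induction hypothesis treats the inner integral and [ge0_integral_density] the outer one. *)
Lemma ge0_integral_power_density
    (nu : {finite_measure set T -> \bar R})
    (mu : {sigma_finite_measure set T -> \bar R}) (g : T -> R) n
    (F : n.-tuple T -> \bar R) :
  measurable_fun setT g -> (forall x, (0 <= g x)%R) ->
  (forall A, measurable A -> nu A = \int[mu]_(x in A) (g x)%:E) ->
  measurable_fun setT F -> (forall t, 0 <= F t) ->
  \int[power_measure nu n]_t F t =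
  \int[power_measure mu n]_t (F t * (\prod_(i < n) g (tnth t i))%:E).
Proof.
move=> mg g0 nuE.
elim: n F => [|n IH] F mF F0.
  have mFp : measurable_fun setT (fun t : 0.-tuple T =>
      F t * (\prod_(i < 0) g (tnth t i))%:E).
    by under eq_fun do rewrite big_ord0 mule1.
  by rewrite /= !integral_dirac//= big_ord0 mule1.
have mprod k : measurable_fun setT
    (fun t : k.-tuple T => ((\prod_(i < k) g (tnth t i))%R)%:E).
  by apply/measurable_EFinP; apply: (measurable_prod_tnth (g := fun=> g)).
have prod0 k (t : k.-tuple T) : (0 <= \prod_(i < k) g (tnth t i))%R.
  by apply: prodr_ge0.
rewrite ge0_integral_power_measureS//.
rewrite ge0_integral_power_measureS//; last 2 first.
- exact: emeasurable_funM mF (mprod _).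
- by move=> t; rewrite mule_ge0// lee_fin.
have mFc : measurable_fun setT (F \o @tuple_cons T n).
  by apply: measurableT_comp => //; exact: measurable_tuple_cons.
under eq_integral => x _.
  rewrite IH//; last first.
    by apply: measurableT_comp mFc _; exact: measurable_pair1.
  over.
have mG : measurable_fun setT (fun z : T * n.-tuple T => F (tuple_cons z) *
    ((\prod_(i < n) g (tnth z.2 i))%R)%:E).
  apply: emeasurable_funM; first exact: mFc.
  exact: (measurableT_comp (mprod n) measurable_snd).
rewrite (ge0_integral_density mg g0 nuE); last 2 first. 
- apply: (measurable_fun_fubini_tonelli_F _ mG).
  by move=> z; rewrite mule_ge0// lee_fin.
- by move=> x; apply: integral_ge0 => t _; rewrite mule_ge0// lee_fin.
apply: eq_integral => x _.
rewrite muleC -ge0_integralZl_EFin//.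
- apply: eq_integral => t _; rewrite big_ord_recl EFinM.
  rewrite (_ : tnth (tuple_cons (x, t)) ord0 = x)//.
  under [in RHS]eq_bigr do rewrite tnthS.
  by rewrite muleCA.
- by move=> t _; rewrite mule_ge0// lee_fin.
- by apply: measurableT_comp mG _; exact: measurable_pair1.
Qed.

Lemma ge0_integral_power_prod (mu : {sigma_finite_measure set T -> \bar R}) n
    (g : 'I_n -> T -> R) :
  (forall i, measurable_fun setT (g i)) -> (forall i x, (0 <= g i x)%R) ->
  \int[power_measure mu n]_t (\prod_(i < n) g i (tnth t i))%:E =
  \prod_(i < n) \int[mu]_x (g i x)%:E.
Proof.
elim: n g => [|n IH] g mg g0.
  rewrite big_ord0 /= integral_dirac//; last first.
    by under eq_fun do rewrite big_ord0; exact: measurable_cst.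
  by rewrite big_ord0 diracT mul1e.
rewrite big_ord_recl -IH//.
rewrite ge0_integral_power_measureS//; last 2 first.
- by apply/measurable_EFinP; apply: (measurable_prod_tnth mg).
- by move=> t; rewrite lee_fin prodr_ge0.
rewrite -ge0_integralZr//; last 3 first.
- exact/measurable_EFinP.
- by move=> x _; rewrite lee_fin.
- by apply: integral_ge0 => t _; rewrite lee_fin prodr_ge0.
apply: eq_integral => x _.
rewrite -ge0_integralZl_EFin//.
- apply: eq_integral => t _; rewrite big_ord_recl EFinM.
  rewrite (_ : tnth (tuple_cons (x, t)) ord0 = x)//.
  by under [in LHS]eq_bigr do rewrite tnthS.
- by move=> t _; rewrite lee_fin prodr_ge0.
- by apply/measurable_EFinP; apply: (measurable_prod_tnth (g := fun i => g
  (lift ord0 i))).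
Qed.

End measure_density.

(** * Measurability and volumes on row vectors *)

Section row_space.
Context {R : realType} {d : nat}.
Local Notation rV := ('rV[R]_d).

Lemma measurable_row_box (A : 'I_d -> set R) :
  (forall i, measurable (A i)) ->
  measurable [set x : rV | forall i, A i (x ord0 i)].
Proof.
move=> mA; rewrite (_ : mkset _ = \bigcap_(i in [set: 'I_d])
    ((fun x : rV => x ord0 i) @^-1` A i)); last first.
  by apply/seteqP; split => [x h i _|x h i]; [exact: h|exact: (h i)].
apply: fin_bigcap_measurable => // i _.
by rewrite -[X in measurable X]setTI; exact: measurable_row_coord.
Qed.

(** The sigma-algebra is generated by coordinates and the balls of the sup norm are boxes, so an
    open set is a countable union of boxes with rational corners. Boxes that leave [U] are replaced
    by [set0], so that the union runs over a whole countable type. *)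
Lemma open_measurable_row (U : set rV) : open U -> measurable U.
Proof.
move=> oU.
pose box (pq : 'rV[rat]_d * 'rV[rat]_d) := [set x : rV | forall i,
  [set` `](ratr (pq.1 ord0 i) : R), (ratr (pq.2 ord0 i) : R)[] (x ord0 i)].
have -> : U = \bigcup_(pq in [set: 'rV[rat]_d * 'rV[rat]_d])
    (if pselect (box pq `<=` U) then box pq else set0).
  apply/seteqP; split=> [x Ux|x [pq _]]; last first.
    by case: pselect => // sub; exact: sub.
  have /nbhs_ballP[e /= e0 sub] : nbhs x U by exact: open_nbhs_nbhs.
  have pP i : exists q : rat, ratr q \in `](x ord0 i - e), (x ord0 i)[.
    by apply: rat_in_itvoo; rewrite ltrBlDr ltrDl.
  have qP i : exists q : rat, ratr q \in `](x ord0 i), (x ord0 i + e)[.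
    by apply: rat_in_itvoo; rewrite ltrDl.
  pose p : 'rV[rat]_d := \row_i xchoose (pP i).
  pose q : 'rV[rat]_d := \row_i xchoose (qP i).
  have pE i : x ord0 i - e < ratr (p ord0 i) < x ord0 i.
    by rewrite mxE; have := xchooseP (pP i); rewrite in_itv.
  have qE i : x ord0 i < ratr (q ord0 i) < x ord0 i + e.
    by rewrite mxE; have := xchooseP (qP i); rewrite in_itv.
  exists (p, q) => //; case: pselect => [sub'|[]] /=.
    move=> i /=; rewrite in_itv /=.
    by have /andP[_ ->] := pE i; have /andP[-> _] := qE i.
  move=> y Hy; apply: sub; split => // i j; rewrite ord1.
  have := Hy j; rewrite /= in_itv /= => /andP[py yq].
  have /andP[p1 p2] := pE j; have /andP[q1 q2] := qE j.
  by rewrite /ball /= distrC ltr_norml; lra.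
apply: countable_bigcupT_measurable; first exact: countableP.
move=> pq; case: pselect => pqU //=.
apply: (@measurable_row_box
  (fun i => [set` `](ratr (pq.1 ord0 i) : R), (ratr (pq.2 ord0 i) : R)[])) => i.
exact: measurable_itv.
Qed.

Lemma continuous_measurable_row (f : rV -> R) :
  continuous f -> measurable_fun setT f.
Proof.
move=> /continuousP cf; apply: (measurability _ (RGenOpens.measurableE R)).
move=> _ [_ [a [b ->] <-]]; rewrite setTI; apply: open_measurable_row.
exact/cf/interval_open.
Qed.

Lemma ge0_integral_lebesgue_row_prod (g : 'I_d -> R -> R) :
  (forall i, measurable_fun setT (g i)) -> (forall i x, 0 <= g i x) ->
  (\int[lebesgue_row]_x (\prod_(i < d) g i (x ord0 i))%:E =
   \prod_(i < d) \int[lebesgue_measure]_t (g i t)%:E)%E.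
Proof.
move=> mg g0.
have mrow : measurable_fun [set: d.-tuple (measurableTypeR R)]
    (@row_of_tuple R d).
  apply/measurable_fun_rowP => i _ Y mY.
  rewrite (_ : (fun t => _) = fun t : d.-tuple (measurableTypeR R) => tnth t i).
    exact: (@measurable_tnth _ (measurableTypeR R)).
  by apply/funext => t; rewrite mxE.
rewrite /lebesgue_row (ge0_integral_pushforward mrow)//; last 2 first.
- apply/measurable_EFinP; apply: measurable_prod => i _.
  by apply: measurableT_comp => //; exact: measurable_row_coord.
- by move=> x _; rewrite lee_fin prodr_ge0.
rewrite preimage_setT.
rewrite -(@ge0_integral_power_prod _ (measurableTypeR R) R lebesgue_measure d g)//.
by apply: eq_integral => t _ /=; under eq_bigr do rewrite mxE.
Qed.

Lemma lebesgue_row_cube (a b : 'I_d -> R) (l : R) :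
  (forall i, b i - a i = l) -> 0 <= l ->
  lebesgue_row [set x : rV | forall i, a i <= x ord0 i <= b i] = (l ^+ d)%:E.
Proof.
move=> abl l0.
have -> : [set x : rV | forall i, a i <= x ord0 i <= b i] =
    [set x : rV | forall i, [set` `[a i, b i]] (x ord0 i)].
  by apply/seteqP; split => x /= h i; have := h i; rewrite in_itv.
rewrite (@lebesgue_row_box R d (fun i => [set` `[a i, b i]]))//.
under eq_bigr => i _.
  rewrite lebesgue_measure_itv /= lte_fin.
  rewrite (_ : (if _ then _ else _) = l%:E); first over.
  (* The interval formula returns 0 unless [a i < b i]; in that case [l] is 0 as well. *)
  case: ifPn => [_|]; first by rewrite -EFinB abl.
  rewrite -leNgt => h; congr EFin; apply/eqP; rewrite eq_le l0 -(abl i).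
  by rewrite subr_le0 h.
by rewrite prodEFin prodr_const card_ord.
Qed.

Lemma measurable_row_cube (a b : 'I_d -> R) :
  measurable [set x : rV | forall i, a i <= x ord0 i <= b i].
Proof.
have -> : [set x : rV | forall i, a i <= x ord0 i <= b i] =
    [set x : rV | forall i, [set` `[a i, b i]] (x ord0 i)].
  by apply/seteqP; split => x /= h i; have := h i; rewrite in_itv.
apply: (@measurable_row_box (fun i => [set` `[a i, b i]])) => i.
exact: measurable_itv.
Qed.

End row_space.

(** * Two-point lower bound *)

(* This is (p - q / 2) ^ 2 >= 0; it bounds the affinity of two product measures
   from below by the chi-square divergence without passing through the
   Hellinger distance. *)
Lemma min_add_sqr_div_ge (R : realFieldType) (p q : R) :
  0 < p -> 0 <= q -> q <= Num.min p q + q ^+ 2 / p / 4.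
Proof.
move=> p0 q0; have qp0 : 0 <= q ^+ 2 / p by rewrite divr_ge0 ?sqr_ge0// ltW.
have [pq|qp] := leP p q; last by rewrite lerDl mulr_ge0.
suff : 0 <= p * (p + q ^+ 2 / p / 4 - q) by rewrite pmulr_rge0// subr_ge0.
have -> : p * (p + q ^+ 2 / p / 4 - q) = (p - q / 2) ^+ 2.
  by field; rewrite gt_eqF.
exact: sqr_ge0.
Qed.

Section two_point.
Local Open Scope ereal_scope.
Context {d : measure_display} {T : measurableType d} {R : realType}.
Variables (mu : {sigma_finite_measure set T -> \bar R}).
Variables (P Q : probability T R) (p q : T -> R).
Hypotheses (mp : measurable_fun setT p) (mq : measurable_fun setT q).
Hypothesis mqp : measurable_fun setT (fun x => q x ^+ 2 / p x)%R.
Hypotheses (p0 : forall x, (0 < p x)%R) (q0 : forall x, (0 <= q x)%R).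
Hypothesis PE : forall A, measurable A -> P A = \int[mu]_(x in A) (p x)%:E.
Hypothesis QE : forall A, measurable A -> Q A = \int[mu]_(x in A) (q x)%:E.

(** Le Cam's argument: the sum of the two integrals is at least [B] times the integral of the
    minimum of the product densities. That integral is at least 1 minus a quarter of the integral of
    [qn ^+ 2 / pn], which factorises over the sample. *)
Lemma two_point_lower_bound n (A A' : n.-tuple T -> \bar R) (B K : R) :
  measurable_fun setT A -> measurable_fun setT A' ->
  (forall t, 0 <= A t) -> (forall t, 0 <= A' t) ->
  (0 <= B)%R -> (forall t, B%:E <= A t + A' t) ->
  \int[mu]_x (q x ^+ 2 / p x)%:E <= K%:E ->
  (B * (1 - K ^+ n / 4))%:E <=
    \int[power_measure P n]_t A t + \int[power_measure Q n]_t A' t.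
Proof.
move=> mA mA' A0 A'0 B0 BA chi.
have p0' x : (0 <= p x)%R by exact: ltW.
rewrite (ge0_integral_power_density mp p0' PE)//.
rewrite (ge0_integral_power_density mq q0 QE)//.
pose pn (t : n.-tuple T) : R := (\prod_(i < n) p (tnth t i))%R.
pose qn (t : n.-tuple T) : R := (\prod_(i < n) q (tnth t i))%R.
have mpn : measurable_fun setT pn by exact: (measurable_prod_tnth (g := fun=> p)).
have mqn : measurable_fun setT qn by exact: (measurable_prod_tnth (g := fun=> q)).
have pn0 t : (0 < pn t)%R by exact: prodr_gt0.
have qn0 t : (0 <= qn t)%R by exact: prodr_ge0.
pose rn (t : n.-tuple T) : R :=
  (\prod_(i < n) (q (tnth t i) ^+ 2 / p (tnth t i)))%R.
have rnE t : rn t = (qn t ^+ 2 / pn t)%R.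
  by rewrite /rn /qn /pn -prodrXl -prodf_div.
have r0 x : (0 <= q x ^+ 2 / p x)%R by rewrite divr_ge0// sqr_ge0.
have rn0 t : (0 <= rn t)%R by exact: prodr_ge0.
have mrn : measurable_fun setT rn.
  exact: (measurable_prod_tnth (g := fun=> (fun x => q x ^+ 2 / p x)%R)).
pose M := \int[power_measure mu n]_t (Num.min (pn t) (qn t))%:E.
have mmin : measurable_fun setT (fun t => Num.min (pn t) (qn t)).
  exact: measurable_minr.
have min0 t : (0 <= Num.min (pn t) (qn t))%R by rewrite le_min ltW/=.
have M_ge : (1 - K ^+ n / 4)%:E <= M.
  rewrite EFinB leeBlDr//.
  have <- : \int[power_measure mu n]_t (qn t)%:E = 1.
    rewrite (ge0_integral_power_prod mu (g := fun=> q))//.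
    by rewrite big1// => i _; rewrite -QE// probability_setT.
  apply: (@le_trans _ _ (\int[power_measure mu n]_t
      ((Num.min (pn t) (qn t))%:E + (4^-1 * rn t)%:E))).
    apply: ge0_le_integral => //.
    - by move=> t _; rewrite lee_fin.
    - exact/measurable_EFinP.
    - apply: emeasurable_funD; first exact/measurable_EFinP.
      by apply/measurable_EFinP; exact: measurable_funM.
    - by move=> t _; rewrite -EFinD lee_fin rnE mulrC min_add_sqr_div_ge.
  rewrite ge0_integralD//; last 4 first.
  - by move=> t _; rewrite lee_fin.
  - exact/measurable_EFinP.
  - by move=> t _; rewrite lee_fin mulr_ge0.
  - by apply/measurable_EFinP; exact: measurable_funM.
  rewrite leeD2l//.
  under eq_integral do rewrite EFinM.
  rewrite ge0_integralZl_EFin//; last 2 first.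
  - by move=> t _; rewrite lee_fin.
  - exact/measurable_EFinP.
  rewrite mulrC EFinM lee_pmul2l//.
  (* The integral is a product of [n] equal one-point integrals, each at most [K]. *)
  rewrite (ge0_integral_power_prod mu (g := fun=> (fun x => q x ^+ 2 / p x)%R))//.
  elim: n {pn qn rn mpn mqn pn0 qn0 rnE rn0 mrn M mmin min0 A A' mA mA' A0 A'0
    BA} => [|n IH].
    by rewrite big_ord0 expr0.
  rewrite big_ord_recl exprS EFinM; apply: lee_pmul => //.
    by apply: integral_ge0 => x _; rewrite lee_fin.
  by apply: prode_ge0 => i _; apply: integral_ge0 => x _; rewrite lee_fin.
apply: (@le_trans _ _ (\int[power_measure mu n]_t
    (A t * (pn t)%:E + A' t * (qn t)%:E))); last first.
  rewrite ge0_integralD//.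
  - by move=> t _; rewrite mule_ge0// lee_fin ltW.
  - by apply: emeasurable_funM => //; exact/measurable_EFinP.
  - by move=> t _; rewrite mule_ge0// lee_fin.
  - by apply: emeasurable_funM => //; exact/measurable_EFinP.
rewrite EFinM; apply: (@le_trans _ _ (B%:E * M)).
  by rewrite lee_wpmul2l// lee_fin.
rewrite -ge0_integralZl_EFin//; last 2 first.
- by move=> t _; rewrite lee_fin.
- exact/measurable_EFinP.
apply: ge0_le_integral => //.
- by move=> t _; rewrite mule_ge0// lee_fin.
- by apply: emeasurable_funM => //; exact/measurable_EFinP.
- by apply: emeasurable_funD; apply: emeasurable_funM => //; exact/measurable_EFinP.
move=> t _; apply: (@le_trans _ _ ((A t + A' t) * (Num.min (pn t) (qn t))%:E)).
  by rewrite lee_wpmul2r// lee_fin.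
rewrite ge0_muleDl//; apply: leeD.
- by rewrite lee_wpmul2l// lee_fin ge_min lexx.
- by rewrite lee_wpmul2l// lee_fin ge_min lexx orbT.
Qed.

End two_point.

(** * Gradients *)

Section gradient_calculus.
Context {R : realType} {d : nat}.
Local Notation rV := ('rV[R]_d).
Implicit Types (f h : rV -> R) (x y u v : rV).

Lemma dotrDl u v x : dotr (u + v) x = dotr u x + dotr v x.
Proof. by rewrite /dotr -big_split; apply: eq_bigr => i _; rewrite mxE mulrDl. Qed.

Lemma dotrZl (a : R) u x : dotr (a *: u) x = a * dotr u x.
Proof. by rewrite /dotr mulr_sumr; apply: eq_bigr => i _; rewrite mxE mulrA. Qed.

Lemma dotrC u v : dotr u v = dotr v u.
Proof. by apply: eq_bigr => i _; rewrite mulrC. Qed.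

Lemma dotrDr u v x : dotr x (u + v) = dotr x u + dotr x v.
Proof. by rewrite dotrC dotrDl !(dotrC x). Qed.

Lemma dotrZr (a : R) u x : dotr x (a *: u) = a * dotr x u.
Proof. by rewrite dotrC dotrZl (dotrC x). Qed.

Lemma dotr_delta x i : dotr x (delta_mx ord0 i) = x ord0 i.
Proof.
rewrite /dotr (bigD1 i)//= mxE !eqxx mulr1 big1 ?addr0// => j ji.
by rewrite mxE (negPf ji) andbF mulr0.
Qed.

Lemma dotrr_ge0 u : 0 <= dotr u u.
Proof. by apply: sumr_ge0 => i _; rewrite -expr2 sqr_ge0. Qed.

Lemma enorm_sqr u : enorm u ^+ 2 = dotr u u.
Proof. by rewrite /enorm sqr_sqrtr ?dotrr_ge0. Qed.

Lemma coord_le_enorm u i : `|u ord0 i| <= enorm u.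
Proof.
rewrite -(ler_pXn2r (n := 2)) ?nnegrE ?sqrtr_ge0// enorm_sqr real_normK ?num_real//.
rewrite /dotr (bigD1 i)//= expr2 lerDl.
by apply: sumr_ge0 => j _; rewrite -expr2 sqr_ge0.
Qed.

Lemma enorm_le_sqrt (a : R) u : 0 <= a -> (forall i, `|u ord0 i| <= a) ->
  enorm u <= Num.sqrt d%:R * a.
Proof.
move=> a0 ua; rewrite -[a in leRHS]ger0_norm//.
rewrite -sqrtr_sqr -sqrtrM ?ler0n// ler_wsqrtr//.
apply: (@le_trans _ _ (\sum_(i < d) a ^+ 2)).
  apply: ler_sum => i _; rewrite -expr2 -real_normK ?num_real//.
  by rewrite ler_pXn2r ?nnegrE.
by rewrite sumr_const card_ord mulr_natl.
Qed.

(** Carries differentiability and the value of the differential together, so that one calculus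
    serves both the differentiability condition of the class and the formula for the score. *)
Definition has_gradient f x g := is_diff x f (dotr g).

Lemma has_gradient_differentiable f x g : has_gradient f x g -> differentiable f x.
Proof. by case. Qed.

Lemma has_gradientE f x g : has_gradient f x g -> gradient f x = g.
Proof.
move=> fg; apply/rowP => i; rewrite mxE deriveE; last by case: fg.
by rewrite (@diff_val _ _ _ _ _ _ _ fg) dotr_delta.
Qed.

Lemma has_gradient_eq f x g g' : has_gradient f x g -> g = g' -> has_gradient f
  x g'.
Proof. by move=> ? <-. Qed.

Lemma has_gradient_cst (a : R) x : has_gradient (cst a) x 0.
Proof.
apply: is_diff_eq; apply/funext => v.
by rewrite /dotr big1// => i _; rewrite mxE mul0r.
Qed.

Lemma has_gradientD f h x g g' : has_gradient f x g -> has_gradient h x g' ->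
  has_gradient (fun y => f y + h y) x (g + g').
Proof.
move=> fg hg; apply: is_diff_eq (is_diffD fg hg) _.
by apply/funext => v /=; rewrite dotrDl.
Qed.

Lemma has_gradientZ (a : R) f x g : has_gradient f x g ->
  has_gradient (fun y => a * f y) x (a *: g).
Proof.
move=> fg; apply: is_diff_eq (is_diffZ a fg) _.
by apply/funext => v /=; rewrite dotrZl.
Qed.

Lemma has_gradientM f h x g g' : has_gradient f x g -> has_gradient h x g' ->
  has_gradient (fun y => f y * h y) x (f x *: g' + h x *: g).
Proof.
move=> fg hg; apply: is_diff_eq (is_diffM fg hg) _.
by apply/funext => v /=; rewrite dotrDl !dotrZl.
Qed.

Lemma has_gradient_sum (I : Type) (s : seq I) (f : I -> rV -> R) x (g : I -> rV) :
  (forall i, has_gradient (f i) x (g i)) ->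
  has_gradient (fun y => \sum_(i <- s) f i y) x (\sum_(i <- s) g i).
Proof.
move=> fg; elim: s => [|i s IH].
  rewrite big_nil (_ : (fun _ => _) = cst 0); first exact: has_gradient_cst.
  by apply/funext => y; rewrite big_nil.
rewrite big_cons (_ : (fun _ => _) = fun y => f i y + \sum_(i <- s) f i y).
  exact: has_gradientD.
by apply/funext => y; rewrite big_cons.
Qed.

Lemma has_gradient_coord i x :
  has_gradient (fun y => y ord0 i) x (delta_mx ord0 i).
Proof.
(* The coordinate is packaged as a linear map, which is its own differential. *)
have @f : {linear rV -> R}.
  by exists (fun N : rV => N ord0 i); do 2![eexists]; do ?[constructor];
     rewrite ?mxE// => ? *; rewrite ?mxE//; move=> ?; rewrite !mxE.
rewrite (_ : (fun _ => _) = f)//.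
apply: DiffDef; first exact/linear_differentiable/coord_continuous.
rewrite diff_lin; last exact: coord_continuous.
by apply/funext => v; rewrite dotrC dotr_delta.
Qed.

Lemma has_gradient_comp f x g (p : R -> R) p' : has_gradient f x g ->
  is_derive (f x) 1 p p' -> has_gradient (fun y => p (f y)) x (p' *: g).
Proof.
move=> fg pp; have dp : is_diff (f x) p ( *:%R^~ p').
  apply: DiffDef; first by apply/derivable1_diffP; case: pp.
  by rewrite deriv1E; [rewrite derive1E; case: pp => _ ->|case: pp].
apply: is_diff_eq (is_diff_comp fg dp) _.
by apply/funext => v /=; rewrite dotrZl mulrC.
Qed.

Lemma has_gradient_continuous f : (forall x, exists g, has_gradient f x g) ->
  continuous f.
Proof.
move=> fg x; have [g /has_gradient_differentiable] := fg x.
exact: differentiable_continuous.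
Qed.

Lemma has_gradient_dotrr z x :
  has_gradient (fun y => dotr (y - z) (y - z)) x (2 *: (x - z)).
Proof.
have -> : 2 *: (x - z) = \sum_(i < d) ((x - z) ord0 i *: delta_mx ord0 i +
    (x - z) ord0 i *: delta_mx ord0 i).
  rewrite big_split/= -row_sum_delta scaler_nat mulr2n//.
apply: has_gradient_sum => i.
have hc : has_gradient (fun y => (y - z) ord0 i) x (delta_mx ord0 i).
  rewrite (_ : (fun _ => _) = fun y => y ord0 i + cst (- z ord0 i) y).
    apply: has_gradient_eq; last exact: addr0.
    apply: has_gradientD; first exact: has_gradient_coord.
    exact: has_gradient_cst.
  by apply/funext => y; rewrite !mxE.
exact: has_gradientM.
Qed.

End gradient_calculus.

(** * The Gaussian density *)

Section gaussian.
Context {R : realType} {d : nat}.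
Variable sigma : R.
Hypothesis sigma_gt0 : 0 < sigma.
Local Notation rV := ('rV[R]_d).
Local Notation mu := (@lebesgue_row R d).

Definition gauss_peak : R := normal_peak sigma ^+ d.

Definition gauss (x : rV) : R :=
  gauss_peak * expR (- (2 * sigma ^+ 2)^-1 * dotr x x).

Lemma gauss_peak_gt0 : 0 < gauss_peak.
Proof. by rewrite exprn_gt0// normal_peak_gt0// gt_eqF. Qed.

Lemma gauss_gt0 x : 0 < gauss x.
Proof. by rewrite mulr_gt0 ?gauss_peak_gt0 ?expR_gt0. Qed.

Lemma gauss_le_peak x : gauss x <= gauss_peak.
Proof.
rewrite ler_piMr ?(ltW gauss_peak_gt0)// expR_le1 mulNr oppr_le0.
by rewrite mulr_ge0 ?dotrr_ge0// invr_ge0 mulr_ge0 ?sqr_ge0.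
Qed.

Lemma gauss_ge x (D : R) : dotr x x <= D ->
  gauss_peak * expR (- (2 * sigma ^+ 2)^-1 * D) <= gauss x.
Proof.
move=> xD; rewrite ler_pM2l ?gauss_peak_gt0// ler_expR !mulNr lerN2.
by rewrite ler_wpM2l// invr_ge0 mulr_ge0 ?sqr_ge0.
Qed.

Lemma ln_gauss x : ln (gauss x) = ln gauss_peak - (2 * sigma ^+ 2)^-1 * dotr x x.
Proof. by rewrite lnM ?posrE ?gauss_peak_gt0 ?expR_gt0// expRK mulNr. Qed.

Lemma differentiable_gauss x : exists g, has_gradient gauss x g.
Proof.
eexists; apply: has_gradientZ; apply: has_gradient_comp; apply: has_gradientZ.
by have := has_gradient_dotrr 0 x; under eq_fun do rewrite subr0; exact.
Qed.

Lemma continuous_gauss : continuous gauss.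
Proof. exact: has_gradient_continuous differentiable_gauss. Qed.

Lemma measurable_gauss : measurable_fun setT gauss.
Proof. exact: continuous_measurable_row continuous_gauss. Qed.

Lemma continuous_dotr (theta : rV) : continuous (dotr theta).
Proof.
apply: has_gradient_continuous => x;
  exists (\sum_i theta ord0 i *: delta_mx ord0 i).
by apply: has_gradient_sum => i; apply/has_gradientZ/has_gradient_coord.
Qed.

Lemma measurable_expR_dotr (theta : rV) :
  measurable_fun setT (fun x : rV => expR (dotr theta x)).
Proof.
apply: measurableT_comp; first exact: measurable_expR.
exact: continuous_measurable_row (@continuous_dotr theta).
Qed.

(** Completing the square in each coordinate turns the integrand into a constant times a product of
    normal densities with means [sigma ^+ 2 * theta ord0 i], each of mass 1. *)
Lemma gauss_mgf (theta : rV) :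
  (\int[mu]_x (gauss x * expR (dotr theta x))%:E =
   (expR (sigma ^+ 2 / 2 * dotr theta theta))%:E)%E.
Proof.
have s0 : sigma != 0 by rewrite gt_eqF.
have E x : gauss x * expR (dotr theta x) = expR (sigma ^+ 2 / 2 * dotr theta
  theta) *
    \prod_(i < d) normal_pdf (sigma ^+ 2 * theta ord0 i) sigma (x ord0 i).
  under eq_bigr do rewrite (normal_pdfE _ s0).
  rewrite big_split/= prodr_const card_ord -expR_sum.
    rewrite /gauss -/gauss_peak -mulrA -expRD [RHS]mulrCA -expRD;
      congr (_ * expR _).
  rewrite /dotr !mulr_sumr -!big_split; apply: eq_bigr => i _ /=.
  by rewrite -mulr_natr; field.
under eq_integral do rewrite E EFinM.
have pdf0 (x : rV) :
    0 <= \prod_(i < d) normal_pdf (sigma ^+ 2 * theta ord0 i) sigma (x ord0 i).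
  by apply: prodr_ge0 => i _; exact: normal_pdf_ge0.
rewrite ge0_integralZl_EFin//; last 2 first.
- by move=> x _; rewrite lee_fin.
- apply/measurable_EFinP; apply: measurable_prod => i _.
  by apply: measurableT_comp; [exact: measurable_normal_pdf|exact:
    measurable_row_coord].
rewrite (ge0_integral_lebesgue_row_prod
  (g := fun i => normal_pdf (sigma ^+ 2 * theta ord0 i) sigma)).
- by rewrite big1 ?mule1// => i _; exact: integral_normal_pdf.
- by move=> i; exact: measurable_normal_pdf.
- by move=> i x; exact: normal_pdf_ge0.
Qed.

Lemma integral_gauss : (\int[mu]_x (gauss x)%:E = 1)%E.
Proof.
have := gauss_mgf 0; rewrite /dotr big1 ?mulr0 ?expR0; last first.
  by move=> i _; rewrite mxE mul0r.
move=> <-; apply: eq_integral => x _; rewrite big1 ?expR0 ?mulr1// => i _.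
by rewrite mxE mul0r.
Qed.

Lemma integrable_gauss_exp (theta : rV) :
  mu.-integrable setT (fun x => (gauss x * expR (dotr theta x))%:E).
Proof.
apply/integrableP; split.
  apply/measurable_EFinP; apply: measurable_funM; first exact: measurable_gauss.
  exact: measurable_expR_dotr.
under eq_integral => x _ do
  rewrite gee0_abs ?lee_fin ?(mulr_ge0 (ltW (gauss_gt0 x)) (expR_ge0 _))//.
by rewrite gauss_mgf ltry.
Qed.

Lemma integrable_gauss : mu.-integrable setT (EFin \o gauss).
Proof.
apply/integrableP; split; first by apply/measurable_EFinP; exact: measurable_gauss.
under eq_integral => x _ do rewrite /= (ger0_norm (ltW (gauss_gt0 x))).
by rewrite integral_gauss ltry.
Qed.

(** Domination by two exponential moments: [|t| <= expR t + expR (- t)]. *)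
Lemma integrable_gauss_coord i :
  mu.-integrable setT (fun x : rV => (gauss x * x ord0 i)%:E).
Proof.
pose t : rV := delta_mx ord0 i.
have := integrableD measurableT (integrable_gauss_exp t) (integrable_gauss_exp
  (- 1 *: t)).
apply: le_integrable => //.
  apply/measurable_EFinP; apply: measurable_funM; first exact: measurable_gauss.
  exact: measurable_row_coord.
move=> x _ /=; rewrite lee_fin dotrZl dotrC dotr_delta mulN1r -mulrDr.
rewrite !normrM ler_wpM2l// [leRHS]ger0_norm ?addr_ge0 ?expR_ge0//.
have := expR_ge1Dx (x ord0 i); have := expR_ge1Dx (- x ord0 i).
have := expR_ge0 (x ord0 i); have := expR_ge0 (- x ord0 i).
by rewrite ler_norml; lra.
Qed.

(* The mean [a] satisfies [t a <= e^(sigma^2 t^2 / 2) - 1] for every real [t]. *)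
Lemma gauss_mean i : (\int[mu]_x (gauss x * x ord0 i)) = 0.
Proof.
set a := Rintegral _ _ _.
have key t : t * a <= expR (sigma ^+ 2 / 2 * t ^+ 2) - 1.
  pose th : rV := t *: delta_mx ord0 i.
  have Ith := integrable_gauss_exp th.
  have Ic : mu.-integrable setT (EFin \o (fun x : rV => t * (gauss x * x ord0 i))).
    by have := integrableZl measurableT t (integrable_gauss_coord i).
  have : \int[mu]_x (gauss x + t * (gauss x * x ord0 i)) <=
      \int[mu]_x (gauss x * expR (dotr th x)).
    apply: le_Rintegral => //.
      by have := integrableD measurableT integrable_gauss Ic.
    move=> x _; rewrite /th dotrZl dotrC dotr_delta.
    rewrite (_ : _ + _ = gauss x * (1 + t * x ord0 i)); last by ring.
    by rewrite ler_pM2l ?gauss_gt0// expR_ge1Dx.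
  rewrite RintegralD//; last exact: integrable_gauss.
  rewrite (RintegralZl (f := fun x : rV => gauss x * x ord0 i))//; last first.
    exact: integrable_gauss_coord.
  rewrite -/a /Rintegral integral_gauss gauss_mgf /=.
  rewrite /th dotrZl dotrC dotr_delta mxE mxE !eqxx mulr1 expr2; lra.
have bound t : 0 <= t -> sigma ^+ 2 * t ^+ 2 <= 1 -> `|a| * t <= sigma ^+ 2 * t
  ^+ 2.
  move=> t0 st.
  (* For [0 <= y <= 1 / 2], [expR y <= 1 / (1 - y)] gives [expR y - 1 <= 2 * y]. *)
  have h : expR (sigma ^+ 2 / 2 * t ^+ 2) - 1 <= sigma ^+ 2 * t ^+ 2.
    set y := sigma ^+ 2 / 2 * t ^+ 2.
    have y0 : 0 <= y by rewrite mulr_ge0 ?divr_ge0 ?sqr_ge0.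
    have yE : sigma ^+ 2 * t ^+ 2 = 2 * y by rewrite /y; field.
    have := expR_ge1Dx (- y); rewrite expRN => h.
    have e0 := expR_gt0 y.
    have : (1 - y) * expR y <= 1 by rewrite -ler_pdivlMr// div1r.
    rewrite yE; move: st; rewrite yE => st h2.
    nra.
  have := key t; have := key (- t); rewrite sqrrN.
  by case: (ger0P a) => _; nra.
apply/eqP; rewrite -normr_eq0 eq_le normr_ge0 andbT leNgt; apply/negP => a0.
pose s2 := sigma ^+ 2; have s20 : 0 < s2 by rewrite exprn_gt0.
(* The second entry makes [bound] applicable; the first makes its right-hand side at most half of
   its left-hand side, a contradiction. *)
pose t := Num.min (`|a| / (2 * s2)) sigma^-1.
have t0 : 0 < t by rewrite lt_min divr_gt0 ?mulr_gt0// invr_gt0.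
have t1 : sigma * t <= 1.
  by rewrite mulrC -ler_pdivlMr// div1r ge_min lexx orbT.
have t2 : s2 * t <= `|a| / 2.
  have : t <= `|a| / (2 * s2) by rewrite ge_min lexx.
  by rewrite ler_pdivlMr ?mulr_gt0//; lra.
have st1 : sigma ^+ 2 * t ^+ 2 <= 1.
  by rewrite -exprMn exprn_ile1// mulr_ge0// ltW.
have := bound t (ltW t0) st1.
by rewrite -/s2 expr2 mulrA ler_pM2r//; lra.
Qed.

End gaussian.

(** * Bumps with disjoint supports *)

Section euclidean.
Context {R : realType} {d : nat}.
Local Notation rV := ('rV[R]_d).
Implicit Types (u v x y z : rV).

Lemma enorm_ge0 u : 0 <= enorm u.
Proof. exact: sqrtr_ge0. Qed.

(** Cauchy-Schwarz, by expanding the squared norm of [enorm v *: u - enorm u *: v]; the case of a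
    zero vector is separate because the common factor is then divided out. *)
Lemma dotr_le_enorm u v : dotr u v <= enorm u * enorm v.
Proof.
have [u0|u0] := eqVneq (enorm u) 0; last have [v0|v0] := eqVneq (enorm v) 0.
- rewrite u0 mul0r /dotr big1// => i _; have := coord_le_enorm u i.
  by rewrite u0 normr_le0 => /eqP ->; rewrite mul0r.
- rewrite v0 mulr0 /dotr big1// => i _; have := coord_le_enorm v i.
  by rewrite v0 normr_le0 => /eqP ->; rewrite mulr0.
have u1 : 0 < enorm u by rewrite lt_def u0 enorm_ge0.
have v1 : 0 < enorm v by rewrite lt_def v0 enorm_ge0.
have := dotrr_ge0 (enorm v *: u + - enorm u *: v).
rewrite !(dotrDl, dotrDr, dotrZl, dotrZr) -!enorm_sqr (dotrC v u) => h.
have : 0 <= (2 * (enorm u * enorm v)) * (enorm u * enorm v - dotr u v) by lra.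
by rewrite pmulr_rge0 ?subr_ge0// !mulr_gt0.
Qed.

Lemma enormB_le u v : enorm v - enorm u <= enorm (u - v).
Proof.
have [h|h] := leP (enorm v) (enorm u).
  by rewrite (le_trans _ (enorm_ge0 _))// subr_le0.
rewrite -(ler_pXn2r (n := 2)) ?nnegrE ?enorm_ge0 ?subr_ge0 ?(ltW h)//.
rewrite sqrrB !enorm_sqr.
have -> : u - v = u + -1 *: v by rewrite scaleN1r.
rewrite !(dotrDl, dotrDr, dotrZl, dotrZr) (dotrC v u).
by have := dotr_le_enorm u v; rewrite mulrC; lra.
Qed.

Lemma enormC u v : enorm (u - v) = enorm (v - u).
Proof.
rewrite /enorm; congr Num.sqrt; apply: eq_bigr => i _.
by rewrite !mxE; ring.
Qed.

End euclidean.

Section positive_part_square.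
Context {R : realType}.

(** Reduces the derivative of the squared positive part, at its kink too, to an algebraic inequality
    checked by cases on signs. *)
Lemma is_derive_quadratic (p : R -> R) (u c C : R) :
  (forall h, `|p (u + h) - p u - c * h| <= C * h ^+ 2) -> is_derive u 1 p c.
Proof.
move=> H.
have cv : h^-1 *: ((p \o shift u) (h *: (1 : R)) - p u) @[h --> 0^'] --> c.
  apply/cvgrPdist_le => e e0.
  have C0 : 0 <= C.
    by rewrite -[C]mulr1 -(expr1n _ 2) (le_trans (normr_ge0 _) (H 1)).
  near=> h.
  have h0 : h != 0 by near: h; exact: nbhs_dnbhs_neq.
  rewrite /= [h%:A]mulr1 (_ : _ - _ = - (h^-1 * (p (u + h) - p u - c * h))).
    rewrite normrN normrM normfV ler_pdivrMl ?normr_gt0//.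
    apply: (le_trans (H h)); rewrite -[h ^+ 2]ger0_norm ?sqr_ge0// normrX expr2.
    rewrite mulrCA ler_wpM2l ?normr_ge0//.
    (* [C + 1] and not [C], which may be 0. *)
    have : `|h| <= e / (C + 1).
      by near: h; apply: dnbhs0_le; rewrite divr_gt0// ltr_wpDl.
    rewrite ler_pdivlMr ?ltr_wpDl// => h1; apply: le_trans h1.
    by rewrite mulrC ler_wpM2l// lerDl.
  by rewrite [h + u]addrC /GRing.scale /=; field.
by split; [apply/cvg_ex; exists c|apply/cvg_lim].
Unshelve. all: by end_near. Qed.

Lemma is_derive_maxr0_sqr (u : R) :
  is_derive u 1 (fun t : R => Num.max 0 t ^+ 2) (2 * Num.max 0 u).
Proof.
apply: (@is_derive_quadratic _ _ _ 1) => h; rewrite ler_norml.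
by case: (leP 0 (u + h)) => h1; case: (leP 0 u) => h2; nra.
Qed.

End positive_part_square.

Section bump.
Context {R : realType} {d : nat}.
Local Notation rV := ('rV[R]_d).
Variables (r : R) (z : rV).
Hypothesis r0 : 0 < r.
Implicit Types (x y : rV).

(* The square of [cap] is the bump: it is C^1 with Lipschitz gradient, which is
   all that the class requires. *)
Definition cap x : R := Num.max 0 (r ^+ 2 - dotr (x - z) (x - z)).

Lemma cap_ge0 x : 0 <= cap x.
Proof. by rewrite le_max lexx. Qed.

Lemma cap_le x : cap x <= r ^+ 2.
Proof. by rewrite ge_max sqr_ge0/= lerBlDr lerDl dotrr_ge0. Qed.

Lemma cap_neq0 x : cap x != 0 -> enorm (x - z) < r.
Proof.
apply: contraTT; rewrite -leNgt => h; rewrite negbK; apply/eqP/max_l.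
by rewrite subr_le0 -enorm_sqr ler_pXn2r ?nnegrE ?enorm_ge0// ltW.
Qed.

Lemma has_gradient_cap_sqr x :
  has_gradient (fun y => cap y ^+ 2) x (- (4 * cap x) *: (x - z)).
Proof.
have hg : has_gradient (fun y => r ^+ 2 - dotr (y - z) (y - z)) x
    (0 + -1 *: (2 *: (x - z))).
  rewrite (_ : (fun _ => _) =
    fun y => cst (r ^+ 2) y + -1 * dotr (y - z) (y - z)).
    apply: has_gradientD; first exact: has_gradient_cst.
    exact/has_gradientZ/has_gradient_dotrr.
  by apply/funext => y; rewrite mulN1r.
apply: has_gradient_eq (has_gradient_comp hg (is_derive_maxr0_sqr _)) _.
by rewrite add0r !scalerA; congr (_ *: _); rewrite /cap; ring.
Qed.

(** [cap] depends only on the distance [t] to [z], as the positive part of [r ^+ 2 - t ^+ 2], whose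
    slope on [[0, r]] is at most [2 * r]; distances differ by at most [enorm (x - y)]. *)
Lemma cap_lipschitz x y : `|cap x - cap y| <= 2 * r * enorm (x - y).
Proof.
wlog h : x y / enorm (x - z) <= enorm (y - z).
  move=> H; have [h|/ltW h] := leP (enorm (x - z)) (enorm (y - z)); first exact: H.
  by rewrite distrC enormC H.
have := enormB_le (x - z) (y - z); rewrite opprB addrA subrK.
rewrite /cap -!enorm_sqr.
move: (enorm_ge0 (x - z)) h; set a := enorm (x - z); set b := enorm (y - z).
set D := enorm (x - y) => a0 ab bD.
have h1 : 0 <= r * (D - (b - a)) by rewrite mulr_ge0 ?subr_ge0// ltW.
have ab2 : 0 <= (b - a) * (b + a)
  by rewrite mulr_ge0 ?subr_ge0// addr_ge0// (le_trans a0).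
have ler t : 0 <= t -> 0 <= r ^+ 2 - t ^+ 2 -> t <= r.
  by move=> t0; rewrite subr_ge0 ler_pXn2r ?nnegrE ?(ltW r0).
have ltr t : 0 <= t -> r ^+ 2 - t ^+ 2 < 0 -> r <= t.
  by move=> t0; rewrite subr_lt0 ltr_pXn2r ?nnegrE ?(ltW r0)// => /ltW.
have b0 := le_trans a0 ab.
have a1 : 0 <= r - a -> 0 <= (b - a) * (r - a) by move=> ?;
  rewrite mulr_ge0// subr_ge0.
have b1 : 0 <= r - b -> 0 <= (b - a) * (r - b) by move=> ?;
  rewrite mulr_ge0// subr_ge0.
rewrite ler_norml; apply/andP.
case: (leP 0 (r ^+ 2 - a ^+ 2)) => h2; case: (leP 0 (r ^+ 2 - b ^+ 2)) => h3.
- have := ler _ a0 h2; have := ler _ b0 h3; rewrite -!(subr_ge0 _ r) => /b1 ? /a1 ?.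
  by split; lra.
- have := ler _ a0 h2; have := ltr _ b0 h3 => br ar.
  have ? : 0 <= (r - a) ^+ 2 by exact: sqr_ge0.
  have ? : 0 <= r * (b - r) by rewrite mulr_ge0 ?subr_ge0 ?(ltW r0).
  by split; lra.
- by split; lra.
- have ? : 0 <= r * (b - a) by rewrite mulr_ge0 ?subr_ge0 ?(ltW r0).
  by split; lra.
Qed.

(** With [x] the point nearer to [z], either both caps vanish or [x] lies within [r] of [z]. The
    product then splits into [cap y] times a difference of coordinates, at most [r ^+ 2], and a
    difference of caps times a coordinate below [r], at most [2 * r ^+ 2], both in units of
    [enorm (x - y)]. *)
Lemma cap_coord_lipschitz i x y :
  `|cap x * (x - z) ord0 i - cap y * (y - z) ord0 i| <= 3 * r ^+ 2 * enorm (x - y).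
Proof.
wlog h : x y / enorm (x - z) <= enorm (y - z).
  move=> H; have [h|/ltW h] := leP (enorm (x - z)) (enorm (y - z)); first exact: H.
  by rewrite distrC enormC H.
have D0 := enorm_ge0 (x - y).
have [c0|/cap_neq0 xr] := eqVneq (cap x) 0.
  have [c0'|/cap_neq0 yr] := eqVneq (cap y) 0.
    by rewrite c0 c0' !mul0r subr0 normr0 !mulr_ge0 ?(ltW r0).
  exfalso; move: c0; rewrite /cap -enorm_sqr.
  case: leP => h1 h2.
    have : enorm (x - z) ^+ 2 < r ^+ 2.
      by rewrite ltr_pXn2r ?nnegrE ?enorm_ge0 ?ltW// (le_lt_trans h).
    lra.
  have : enorm (x - z) ^+ 2 < r ^+ 2.
    by rewrite ltr_pXn2r ?nnegrE ?enorm_ge0 ?ltW// (le_lt_trans h).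
  lra.
rewrite (_ : _ - _ = cap y * (x - y) ord0 i + (cap x - cap y) * (x - z) ord0 i).
  have e1 : `|cap y * (x - y) ord0 i| <= r ^+ 2 * enorm (x - y).
    rewrite normrM ger0_norm ?cap_ge0// ler_pM ?cap_ge0 ?cap_le//.
    exact: coord_le_enorm.
  have e2 : `|(cap x - cap y) * (x - z) ord0 i| <= 2 * r * enorm (x - y) * r.
    rewrite normrM ler_pM// ?cap_lipschitz//.
    exact: le_trans (coord_le_enorm _ _) (ltW xr).
  have := ler_normD (cap y * (x - y) ord0 i) ((cap x - cap y) * (x - z) ord0 i).
  lra.
by rewrite !mxE; ring.
Qed.

End bump.

Section disjoint_sums.
Context {R : realType} {J : finType}.

(** Used with [a] the values at one point of functions with disjoint supports; it makes bounds on
    their sums independent of how many functions there are. *)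
Definition at_most_one (a : J -> R) := forall i j, i != j -> a i = 0 \/ a j = 0.

Lemma at_most_one_count (a : J -> R) : at_most_one a ->
  \sum_j (a j != 0)%:R <= 1 :> R.
Proof.
move=> a1; have [/existsP[j aj]|] := boolP [exists j, a j != 0].
  rewrite (bigD1 j)//= aj big1 ?addr0// => i ij.
  by case: (a1 _ _ ij) => [->|aj0]; [rewrite eqxx|rewrite aj0 eqxx in aj].
rewrite negb_exists => /forallP a0; rewrite big1 ?ler01// => j _.
by rewrite (negPf (a0 j)).
Qed.

Lemma at_most_one_normr_le (w a : J -> R) (M : R) : at_most_one a ->
  (forall j, `|w j| <= 1) -> (forall j, `|a j| <= M) -> 0 <= M ->
  `|\sum_j w j * a j| <= M.
Proof.
move=> a1 w1 aM M0; apply: (le_trans (ler_norm_sum _ _ _)).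
apply: (@le_trans _ _ (\sum_j M * (a j != 0)%:R)).
  apply: ler_sum => j _; have [->|_] := eqVneq (a j) 0.
    by rewrite mulr0 normr0 mulr0.
  by rewrite mulr1 normrM -[M]mul1r ler_pM.
by rewrite -mulr_sumr -[leRHS]mulr1 ler_wpM2l// at_most_one_count.
Qed.

(** Two points may activate two different indices, hence the factor 2. *)
Lemma at_most_one_normrB_le (w a b : J -> R) (M : R) :
  at_most_one a -> at_most_one b ->
  (forall j, `|w j| <= 1) -> (forall j, `|a j - b j| <= M) -> 0 <= M ->
  `|\sum_j w j * a j - \sum_j w j * b j| <= 2 * M.
Proof.
move=> a1 b1 w1 abM M0; rewrite -sumrB; apply: (le_trans (ler_norm_sum _ _ _)).
apply: (@le_trans _ _ (\sum_j M * ((a j != 0)%:R + (b j != 0)%:R))).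
  apply: ler_sum => j _; rewrite -mulrBr.
  have h : `|w j * (a j - b j)| <= M by rewrite normrM -[M]mul1r ler_pM.
  have [aj|aj] := eqVneq (a j) 0; have [bj|bj] := eqVneq (b j) 0;
    rewrite ?addr0 ?add0r ?mulr1//.
    by rewrite aj bj subr0 mulr0 normr0 mulr0.
  by rewrite (le_trans h)// ler_peMr// lerDl.
rewrite -mulr_sumr big_split/= mulrC ler_wpM2r//.
have := at_most_one_count a1; have := at_most_one_count b1; lra.
Qed.

End disjoint_sums.

(** * Integration against measures given by densities *)

Section density_tools.
Context {dT : measure_display} {T : measurableType dT} {R : realType}.

Lemma probability_of_density (mu : {measure set T -> \bar R}) (f : T -> R) :
  measurable_fun setT f -> (forall x, 0 <= f x) ->
  (\int[mu]_x (f x)%:E = 1)%E ->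
  exists P : probability T R,
    forall A, measurable A -> P A = (\int[mu]_(x in A) (f x)%:E)%E.
Proof.
move=> mf f0 f1.
pose m (A : set T) := (\int[mu]_(x in A) (f x)%:E)%E.
have m0 : m set0 = 0%E by rewrite /m integral_set0.
have mge0 A : (0 <= m A)%E by apply: integral_ge0 => x _; rewrite lee_fin.
have msa : semi_sigma_additive m.
  move=> F mF tF mUF; rewrite /m ge0_integral_bigcup//.
  - by apply: is_cvg_ereal_nneg_natsum_cond => n _ _; exact: mge0.
  - by apply/measurable_EFinP; exact: measurable_funTS.
  - by move=> x _; rewrite lee_fin.
pose mM := isMeasure.Build _ _ _ m m0 mge0 msa.
pose mm : {measure set T -> \bar R} := HB.pack m mM.
pose pM := @Measure_isProbability.Build _ _ _ mm f1.
by exists (HB.pack_for (probability T R) (mm : set T -> \bar R) mM pM).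
Qed.

Lemma integral_density (nu : {finite_measure set T -> \bar R})
    (mu : {sigma_finite_measure set T -> \bar R}) (g f : T -> R) :
  measurable_fun setT g -> (forall x, 0 <= g x) ->
  (forall A, measurable A -> nu A = (\int[mu]_(x in A) (g x)%:E)%E) ->
  measurable_fun setT f ->
  (\int[nu]_x (f x)%:E = \int[mu]_x (g x * f x)%:E)%E.
Proof.
move=> mg g0 nuE mf; rewrite integralE [in RHS]integralE.
have mfE : measurable_fun setT (EFin \o f) by exact/measurable_EFinP.
rewrite (ge0_integral_density mg g0 nuE)//; last exact: measurable_funepos.
rewrite (ge0_integral_density mg g0 nuE)//; last exact: measurable_funeneg.
congr (_ - _)%E; apply: eq_integral => x _.
  rewrite !funeposE -!EFin_max -EFinM; congr EFin.
  by rewrite mulrC maxr_pMr// mulr0.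
rewrite !funenegE -!EFinN -!EFin_max -EFinM; congr EFin.
by rewrite mulrC maxr_pMr// mulr0 mulrN.
Qed.

Lemma integrable_density (nu : {finite_measure set T -> \bar R})
    (mu : {sigma_finite_measure set T -> \bar R}) (g f : T -> R) :
  measurable_fun setT g -> (forall x, 0 <= g x) ->
  (forall A, measurable A -> nu A = (\int[mu]_(x in A) (g x)%:E)%E) ->
  measurable_fun setT f ->
  mu.-integrable setT (fun x => (g x * f x)%:E) ->
  nu.-integrable setT (fun x => (f x)%:E).
Proof.
move=> mg g0 nuE mf /integrableP[_ gf].
apply/integrableP; split; first exact/measurable_EFinP.
have mnf : measurable_fun setT (fun x => `|f x|) by exact: measurableT_comp.
rewrite [X in (X < _)%E](integral_density mg g0 nuE mnf).
apply: le_lt_trans gf; rewrite le_eqVlt; apply/orP; left; apply/eqP.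
by apply: eq_integral => x _ /=; rewrite normrM (ger0_norm (g0 x)).
Qed.

(** Integrability and value are proved in one induction, because additivity of the real-valued
    integral uses the integrability of the partial sum. *)
Lemma Rintegral_sum (mu : {measure set T -> \bar R}) (I : Type) (s : seq I)
    (f : I -> T -> R) :
  (forall i, mu.-integrable setT (fun x => (f i x)%:E)) ->
  mu.-integrable setT (fun x => (\sum_(i <- s) f i x)%:E) /\
  \int[mu]_x (\sum_(i <- s) f i x) = \sum_(i <- s) \int[mu]_x f i x.
Proof.
move=> fi; elim: s => [|i s [IH1 IH2]].
  rewrite big_nil; split.
    under eq_fun do rewrite big_nil.
    exact: integrable0.
  by under eq_Rintegral do rewrite big_nil; rewrite Rintegral_cst// mul0r.
split.
  under eq_fun do rewrite big_cons EFinD.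
  exact: (integrableD measurableT (fi i) IH1).
rewrite (@eq_Rintegral _ _ _ _ _ (fun x => f i x + \sum_(i <- s) f i x));
  last first.
  by move=> x _; rewrite big_cons.
rewrite big_cons -IH2 (RintegralD (f1 := f i))//; exact: fi.
Qed.

Lemma RintegralZD (mu : {measure set T -> \bar R}) (a : R) (f g : T -> R) :
  mu.-integrable setT (fun x => (f x)%:E) ->
  mu.-integrable setT (fun x => (g x)%:E) ->
  mu.-integrable setT (fun x => (a * f x + g x)%:E) /\
  \int[mu]_x (a * f x + g x) = a * \int[mu]_x f x + \int[mu]_x g x.
Proof.
move=> fi gi; have afi : mu.-integrable setT (fun x => (a * f x)%:E).
  by have := integrableZl measurableT a fi.
split; first exact: (integrableD measurableT afi gi).
by rewrite (RintegralD (f1 := fun x => a * f x))// (RintegralZl (f := f)).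
Qed.

Lemma integrableM_bounded (mu : {measure set T -> \bar R}) (f h : T -> R) (M : R) :
  mu.-integrable setT (fun x => (f x)%:E) -> measurable_fun setT h ->
  (forall x, `|h x| <= M) -> mu.-integrable setT (fun x => (f x * h x)%:E).
Proof.
move=> fi mh hM; have := integrableZl measurableT M fi.
apply: le_integrable => //.
  apply/measurable_EFinP; apply: measurable_funM => //.
  by apply/measurable_EFinP; exact: measurable_int fi.
move=> x _ /=; rewrite lee_fin !normrM mulrC ler_wpM2r//.
by rewrite (le_trans (hM x))// ler_norm.
Qed.

End density_tools.

(** * Perturbed Gaussian densities *)

Section perturbed_gaussian.
Context {R : realType} {d : nat} {J : finType}.
Local Notation rV := ('rV[R]_d).
Local Notation mu := (@lebesgue_row R d).
Variables (sigma r eps : R) (z : J -> rV) (w : J -> R).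
Hypotheses (sigma_gt0 : 0 < sigma) (r_gt0 : 0 < r) (r_le1 : r <= 1).
Hypotheses (eps_gt0 : 0 < eps) (eps_le : eps <= 1 / 2).
Hypothesis w_le1 : forall j, `|w j| <= 1.
Hypothesis caps_disjoint : forall x, at_most_one (fun j => cap r (z j) x).

(** Scaling of a function with Lipschitz gradient: since [cap] is at most [r ^+ 2], the prefactor
    gives height [eps * r ^+ 2], gradient of order [eps * r], and a Lipschitz constant of the
    gradient free of [r]. *)
Definition pert (x : rV) : R := eps / r ^+ 2 * \sum_j w j * cap r (z j) x ^+ 2.

Definition pert_grad (x : rV) : rV :=
  (eps / r ^+ 2) *: \sum_j w j *: (- (4 * cap r (z j) x) *: (x - z j)).

Definition pert_density (x : rV) : R := gauss sigma x * (1 + pert x).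

Lemma caps_sqr_disjoint x : at_most_one (fun j => cap r (z j) x ^+ 2).
Proof.
move=> i j ij; case: (caps_disjoint x ij) => ->; [left|right];
  by rewrite expr0n.
Qed.

Lemma pert_norm x : `|pert x| <= eps * r ^+ 2.
Proof.
rewrite normrM ger0_norm ?divr_ge0 ?sqr_ge0 ?(ltW eps_gt0)//.
have -> : eps * r ^+ 2 = eps / r ^+ 2 * (r ^+ 2) ^+ 2.
  by field; rewrite gt_eqF.
rewrite ler_wpM2l ?divr_ge0 ?sqr_ge0 ?(ltW eps_gt0)//.
apply: (at_most_one_normr_le (caps_sqr_disjoint x)) => //.
  move=> j; rewrite normrX lerXn2r ?nnegrE ?sqr_ge0//.
  by rewrite ger0_norm ?cap_ge0 ?cap_le.
by rewrite sqr_ge0.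
Qed.

Lemma pert_norm_half x : `|pert x| <= 1 / 2.
Proof.
apply: (le_trans (pert_norm x)).
have : r ^+ 2 <= 1 by rewrite exprn_ile1// ltW.
have := ltW eps_gt0; move: eps_le; nra.
Qed.

Lemma pert_bounds x : 1 / 2 <= 1 + pert x <= 3 / 2.
Proof. by have := pert_norm_half x; rewrite ler_norml; lra. Qed.

Lemma has_gradient_pert x : has_gradient pert x (pert_grad x).
Proof.
apply: has_gradientZ; apply: has_gradient_sum => j.
by apply: has_gradientZ; exact: has_gradient_cap_sqr.
Qed.

Lemma differentiable_pert_density x : differentiable pert_density x.
Proof.
have [g hg] := differentiable_gauss sigma x.
apply: has_gradient_differentiable.
exact: has_gradientM hg (has_gradientD (has_gradient_cst 1 x)
  (has_gradient_pert x)).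
Qed.

Lemma continuous_pert_density : continuous pert_density.
Proof.
by move=> x; exact: differentiable_continuous (differentiable_pert_density x).
Qed.

Lemma measurable_pert_density : measurable_fun setT pert_density.
Proof. exact: continuous_measurable_row continuous_pert_density. Qed.

Lemma pert_density_ge x : gauss sigma x / 2 <= pert_density x.
Proof.
rewrite ler_pM2l ?gauss_gt0//.
by have := pert_bounds x; lra.
Qed.

Lemma pert_density_gt0 x : 0 < pert_density x.
Proof. by rewrite (lt_le_trans _ (pert_density_ge x))// divr_gt0 ?gauss_gt0. Qed.

Lemma pert_density_le x : pert_density x <= 2 * gauss sigma x.
Proof.
rewrite /pert_density [leRHS]mulrC ler_pM2l ?gauss_gt0//.
by have := pert_bounds x; lra.
Qed.

Lemma ln_pert_density x : ln (pert_density x) =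
  ln (gauss_peak (d := d) sigma) - (2 * sigma ^+ 2)^-1 * dotr x x + ln (1 + pert x).
Proof.
rewrite lnM ?posrE ?gauss_gt0// ?ln_gauss//.
by have := pert_bounds x; lra.
Qed.

Lemma has_gradient_ln_pert_density x :
  has_gradient (fun y => ln (pert_density y)) x
    (- (sigma ^+ 2)^-1 *: x + (1 + pert x)^-1 *: pert_grad x).
Proof.
have p0 : 0 < 1 + pert x by have := pert_bounds x; lra.
rewrite (_ : (fun y => ln (pert_density y)) = fun y =>
  (cst (ln (gauss_peak (d := d) sigma)) y + - (2 * sigma ^+ 2)^-1 * dotr y y) +
   ln (1 + pert y)); last first.
  by apply/funext => y; rewrite ln_pert_density mulNr.
apply: has_gradientD.
  apply: has_gradient_eq.
    apply: has_gradientD; first exact: has_gradient_cst.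
    apply: has_gradientZ.
    by have := has_gradient_dotrr 0 x; under eq_fun do rewrite subr0; exact.
  rewrite add0r subr0 scalerA; congr (_ *: _).
  by field; rewrite gt_eqF.
apply: (has_gradient_comp (f := fun y => 1 + pert y)); last exact: is_derive1_ln.
apply: has_gradient_eq.
  by apply: has_gradientD; [exact: (has_gradient_cst 1)|exact: has_gradient_pert].
by rewrite add0r.
Qed.

Lemma score_pert_density x : score pert_density x =
  - (sigma ^+ 2)^-1 *: x + (1 + pert x)^-1 *: pert_grad x.
Proof. exact: has_gradientE (has_gradient_ln_pert_density x). Qed.

Lemma score_pert_density_coord x i : score pert_density x ord0 i =
  - (sigma ^+ 2)^-1 * x ord0 i + (1 + pert x)^-1 * pert_grad x ord0 i.
Proof. by rewrite score_pert_density mxE [X in X + _]mxE [X in _ + X]mxE. Qed.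

Lemma pert_grad_coord x i : pert_grad x ord0 i =
  - 4 * (eps / r ^+ 2) * \sum_j w j * (cap r (z j) x * (x - z j) ord0 i).
Proof.
rewrite mxE summxE !mulr_sumr; apply: eq_bigr => j _.
by rewrite mxE [X in _ * (_ * X)]mxE; ring.
Qed.

Lemma measurable_cap j : measurable_fun setT (cap r (z j)).
Proof.
apply: measurable_maxr => //; apply: measurable_funB => //.
apply: continuous_measurable_row; apply: has_gradient_continuous => x.
by eexists; exact: has_gradient_dotrr.
Qed.

Lemma measurable_score_pert_coord i :
  measurable_fun setT (fun x : rV => score pert_density x ord0 i).
Proof.
rewrite (_ : (fun x => _) = fun x : rV => - (sigma ^+ 2)^-1 * x ord0 i +
  (1 + pert x)^-1 * (- 4 * (eps / r ^+ 2) *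
    \sum_j w j * (cap r (z j) x * (x ord0 i - z j ord0 i)))); last first.
  apply/funext => x; rewrite score_pert_density_coord pert_grad_coord.
  congr (_ + _ * (_ * _)).
  by apply: eq_bigr => j _; rewrite !mxE.
apply: measurable_funD.
  by apply: measurable_funM => //; exact: measurable_row_coord.
apply: measurable_funM.
  apply: continuous_measurable_row => x; apply: differentiable_continuous.
  apply: differentiableV.
    apply: (has_gradient_differentiable (g := 0 + pert_grad x)).
    exact: has_gradientD (has_gradient_cst 1 x) (has_gradient_pert x).
  have p0 : 0 < 1 + pert x by have := pert_bounds x; lra.
  by rewrite gt_eqF.
apply: measurable_funM => //; apply: measurable_sum => j.
apply: measurable_funM => //; apply: measurable_funM; first exact: measurable_cap.
by apply: measurable_funB => //; exact: measurable_row_coord.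
Qed.

Lemma caps_coord_disjoint x i :
  at_most_one (fun j => cap r (z j) x * (x - z j) ord0 i).
Proof.
by move=> j k jk; case: (caps_disjoint x jk) => ->; [left|right]; rewrite mul0r.
Qed.

Let c_ge0 : 0 <= eps / r ^+ 2.
Proof. by rewrite divr_ge0 ?sqr_ge0 ?(ltW eps_gt0). Qed.

Lemma pert_grad_norm x i : `|pert_grad x ord0 i| <= 4 * eps * r.
Proof.
rewrite pert_grad_coord normrM [`|- 4 * _|]normrM normrN.
rewrite [`|eps / _|]ger0_norm// [`|4|]ger0_norm//.
have -> : 4 * eps * r = 4 * (eps / r ^+ 2) * (r ^+ 2 * r).
  by field; rewrite gt_eqF.
rewrite ler_wpM2l ?(mulr_ge0 _ c_ge0)//.
apply: (at_most_one_normr_le (caps_coord_disjoint x i)) => //; last first.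
  by rewrite mulr_ge0 ?sqr_ge0 ?(ltW r_gt0).
move=> j; have [->|/cap_neq0 xr] := eqVneq (cap r (z j) x) 0.
  by rewrite mul0r normr0 mulr_ge0 ?sqr_ge0 ?(ltW r_gt0).
rewrite normrM ger0_norm ?cap_ge0// ler_pM ?cap_ge0 ?cap_le//.
exact: le_trans (coord_le_enorm _ _) (ltW (xr r_gt0)).
Qed.

Lemma pert_lipschitz x y : `|pert x - pert y| <= 8 * eps * r * enorm (x - y).
Proof.
rewrite -mulrBr normrM ger0_norm//.
have -> : 8 * eps * r * enorm (x - y) =
    (eps / r ^+ 2) * (2 * (2 * r ^+ 2 * (2 * r * enorm (x - y)))).
  by field; rewrite gt_eqF.
rewrite ler_wpM2l//.
apply: (at_most_one_normrB_le (caps_sqr_disjoint x) (caps_sqr_disjoint y)) => //.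
  move=> j; rewrite subr_sqr mulrC normrM ler_pM//; last exact: cap_lipschitz.
  rewrite ger0_norm ?addr_ge0 ?cap_ge0//.
  have := cap_le r (z j) x; have := cap_le r (z j) y; lra.
by rewrite !mulr_ge0 ?enorm_ge0 ?(ltW r_gt0).
Qed.

(** 24 = 4 * 2 * 3: the factor 4 of the gradient of a bump, two active bumps, and the constant of
    [cap_coord_lipschitz]. *)
Lemma pert_grad_lipschitz x y i :
  `|pert_grad x ord0 i - pert_grad y ord0 i| <= 24 * eps * enorm (x - y).
Proof.
rewrite !pert_grad_coord -mulrBr normrM [`|- 4 * _|]normrM normrN.
rewrite [`|eps / _|]ger0_norm// [`|4|]ger0_norm//.
have -> : 24 * eps * enorm (x - y) =
    4 * (eps / r ^+ 2) * (2 * (3 * r ^+ 2 * enorm (x - y))).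
  by field; rewrite gt_eqF.
rewrite ler_wpM2l ?(mulr_ge0 _ c_ge0)//.
apply: (at_most_one_normrB_le (caps_coord_disjoint x i) (caps_coord_disjoint y
  i)) => //.
  by move=> j; exact: cap_coord_lipschitz.
by rewrite !mulr_ge0 ?enorm_ge0 ?(ltW r_gt0).
Qed.

(** The square root passes from coordinates to the Euclidean norm and [(sigma ^+ 2)^-1] is the
    Gaussian part. In 104 = 4 * 26, 4 bounds the product of two inverses of [1 + pert], and 26 = 18
    + 8 collects the variation of the gradient and that of the denominator. *)
Definition lipschitz_cst : R := Num.sqrt d%:R * ((sigma ^+ 2)^-1 + 104).

Lemma score_pert_lipschitz : elipschitz lipschitz_cst (score pert_density).
Proof.
move=> x y; rewrite /lipschitz_cst -mulrA.
have D0 := enorm_ge0 (x - y); have s0 : 0 <= (sigma ^+ 2)^-1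
  by rewrite invr_ge0 sqr_ge0.
apply: enorm_le_sqrt => [|i]; first by rewrite mulr_ge0// addr_ge0.
rewrite mxE [X in _ + X]mxE !score_pert_density_coord.
set a := pert_grad x ord0 i; set b := pert_grad y ord0 i.
set p := 1 + pert x; set q := 1 + pert y.
have ab : `|a - b| <= 24 * eps * enorm (x - y) := pert_grad_lipschitz x y i.
have hb : `|b| <= 4 * eps * r := pert_grad_norm y i.
have pq : `|q - p| <= 8 * eps * r * enorm (x - y).
  by rewrite /p /q distrC opprD addrACA subrr add0r pert_lipschitz.
have /andP[p1 p2] := pert_bounds x; have /andP[q1 q2] := pert_bounds y.
rewrite -/p -/q in p1 p2 q1 q2.
have p0 : 0 < p by lra.
have q0 : 0 < q by lra.
have xy : `|x ord0 i - y ord0 i| <= enorm (x - y).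
  by have := coord_le_enorm (x - y) i; rewrite !mxE.
(* The quotients are compared through [a / p - b / q = ((a - b) * q + b * (q - p)) / (p * q)]. *)
rewrite (_ : _ - _ = - (sigma ^+ 2)^-1 * (x ord0 i - y ord0 i) +
    p^-1 * q^-1 * ((a - b) * q + b * (q - p))); last first.
  by field; rewrite !gt_eqF//; lra.
apply: (le_trans (ler_normD _ _)); rewrite [leRHS]mulrDl lerD//.
  by rewrite normrM normrN (ger0_norm s0) ler_wpM2l.
have pq4 : p^-1 * q^-1 <= 4.
  rewrite -invfM invf_ple ?posrE ?mulr_gt0//.
  have : 0 <= (p - 1 / 2) * q by rewrite mulr_ge0 ?subr_ge0// ltW.
  lra.
rewrite normrM [`|_ * q^-1|]ger0_norm ?mulr_ge0 ?invr_ge0 ?(ltW p0) ?(ltW q0)//.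
have -> : 104 * enorm (x - y) = 4 * (26 * enorm (x - y)) by ring.
apply: ler_pM => //; first by rewrite mulr_ge0 ?invr_ge0 ?(ltW p0) ?(ltW q0).
apply: (le_trans (ler_normD _ _)); rewrite !normrM (ger0_norm (ltW q0)).
have e1 : `|a - b| * q <= 24 * eps * enorm (x - y) * (3 / 2).
  by rewrite ler_pM// ltW.
have e2 : `|b| * `|q - p| <= 4 * eps * r * (8 * eps * r * enorm (x - y)).
  by rewrite ler_pM.
apply: (le_trans (lerD e1 e2)).
have er : eps * r <= 1 / 2.
  by have := ltW eps_gt0; have := ltW r_gt0; move: eps_le r_le1; nra.
have er0 : 0 <= eps * r by rewrite mulr_ge0// ltW.
have er2 : (eps * r) * (eps * r) <= 1 / 4 by nra.
have h1 : eps * enorm (x - y) <= 1 / 2 * enorm (x - y) by rewrite ler_wpM2r.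
have h2 : (eps * r) * (eps * r) * enorm (x - y) <= 1 / 4 * enorm (x - y).
  by rewrite ler_wpM2r.
lra.
Qed.

(** * Moments of the perturbed density and membership in the class *)

Hypothesis caps_mass :
  \sum_j w j * \int[mu]_x (gauss sigma x * 1 * cap r (z j) x ^+ 2) = 0.
Hypothesis caps_mean : forall i,
  \sum_j w j * \int[mu]_x (gauss sigma x * x ord0 i * cap r (z j) x ^+ 2) = 0.

Lemma measurable_cap_sqr j : measurable_fun setT (fun x => cap r (z j) x ^+ 2).
Proof.
apply: continuous_measurable_row; apply: has_gradient_continuous => x.
by eexists; exact: has_gradient_cap_sqr.
Qed.

(** Applied with [k] constant for the mass and [k] a coordinate for the mean; the factor [1] in
    [caps_mass] gives both hypotheses this common shape. *)
Lemma pert_moment (k : rV -> R) :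
  mu.-integrable setT (fun x => (gauss sigma x * k x)%:E) ->
  \sum_j w j * \int[mu]_x (gauss sigma x * k x * cap r (z j) x ^+ 2) = 0 ->
  mu.-integrable setT (fun x => (pert_density x * k x)%:E) /\
  \int[mu]_x (pert_density x * k x) = \int[mu]_x (gauss sigma x * k x).
Proof.
move=> ik k0.
have icap j : mu.-integrable setT
    (fun x => (gauss sigma x * k x * cap r (z j) x ^+ 2)%:E).
  apply: (integrableM_bounded ik (measurable_cap_sqr j) (M := (r ^+ 2) ^+ 2)) => x.
  rewrite ger0_norm ?sqr_ge0// lerXn2r ?nnegrE ?cap_ge0 ?sqr_ge0//.
  exact: cap_le.
have iw j : mu.-integrable setT (fun x =>
    (eps / r ^+ 2 * w j * (gauss sigma x * k x * cap r (z j) x ^+ 2))%:E).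
  by have := integrableZl measurableT (eps / r ^+ 2 * w j) (icap j).
have [iS Es] := Rintegral_sum (index_enum J) iw.
have E x : pert_density x * k x = gauss sigma x * k x +
    \sum_j eps / r ^+ 2 * w j * (gauss sigma x * k x * cap r (z j) x ^+ 2).
  rewrite /pert_density /pert mulrDr mulr1 mulrDl; congr (_ + _).
  by rewrite !mulr_sumr mulr_suml; apply: eq_bigr => j _; ring.
split.
  under eq_fun do rewrite E EFinD.
  exact: (integrableD measurableT ik iS).
under eq_Rintegral do rewrite E.
rewrite (RintegralD (f1 := fun x => gauss sigma x * k x))// Es.
rewrite (eq_bigr (fun j => eps / r ^+ 2 *
    (w j * \int[mu]_x (gauss sigma x * k x * cap r (z j) x ^+ 2)))); last first.
  move=> j _; rewrite mulrA.
  rewrite (RintegralZl (f := fun x => gauss sigma x * k x * cap r (z j) x ^+ 2))//.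
  exact: icap.
by rewrite -mulr_sumr k0 mulr0 addr0.
Qed.

Lemma integrable_pert_density : mu.-integrable setT (EFin \o pert_density) /\
  \int[mu]_x pert_density x = 1.
Proof.
have ig : mu.-integrable setT (fun x : rV => (gauss sigma x * 1)%:E).
  by under eq_fun do rewrite mulr1; exact: integrable_gauss.
have [h1 h2] := pert_moment (k := fun=> 1) ig caps_mass; split.
  by move: h1; under eq_fun do rewrite mulr1.
transitivity (\int[mu]_x (pert_density x * 1)).
  by apply: eq_Rintegral => x _; rewrite mulr1.
rewrite h2 /Rintegral; under eq_integral do rewrite mulr1.
by rewrite integral_gauss.
Qed.

Lemma integral_pert_density : (\int[mu]_x (pert_density x)%:E = 1)%E.
Proof.
have [iP E] := integrable_pert_density.
by rewrite -E /Rintegral fineK//; exact: integrable_fin_num.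
Qed.

Lemma pert_density_coord i :
  mu.-integrable setT (fun x : rV => (pert_density x * x ord0 i)%:E) /\
  \int[mu]_x (pert_density x * x ord0 i) = 0.
Proof.
have [? ->] := pert_moment (integrable_gauss_coord sigma_gt0 i) (caps_mean i).
by split => //; exact: gauss_mean.
Qed.

Lemma Rintegral_dotr (h : rV -> R) (theta : rV) :
  (forall i, mu.-integrable setT (fun x : rV => (h x * x ord0 i)%:E)) ->
  (forall i, \int[mu]_x (h x * x ord0 i) = 0) ->
  mu.-integrable setT (fun x : rV => (h x * dotr theta x)%:E) /\
  \int[mu]_x (h x * dotr theta x) = 0.
Proof.
move=> hi h0.
have iw i : mu.-integrable setT (fun x : rV =>
    (theta ord0 i * (h x * x ord0 i))%:E).
  by have := integrableZl measurableT (theta ord0 i) (hi i).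
have [iS Es] := Rintegral_sum (index_enum 'I_d) iw.
have E x : h x * dotr theta x = \sum_i theta ord0 i * (h x * x ord0 i).
  by rewrite /dotr mulr_sumr; apply: eq_bigr => i _; ring.
split; first by under eq_fun do rewrite E.
under eq_Rintegral do rewrite E.
rewrite Es big1// => i _.
rewrite (RintegralZl (f := fun x : rV => h x * x ord0 i))// ?h0 ?mulr0//.
exact: hi.
Qed.

(* Since [E e^u = 1 + E (e^u - 1 - u)] for centred [u] and [e^u - 1 - u >= 0],
   the bound [pert_density <= 2 * gauss] gives [1 + 2 (e^y - 1) <= e^(2 y)]. *)
Lemma pert_density_mgf (theta : rV) :
  (\int[mu]_x (pert_density x * expR (dotr theta x))%:E <=
   (expR (sigma ^+ 2 * dotr theta theta))%:E)%E.
Proof.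
pose E (x : rV) := expR (dotr theta x).
have iE := integrable_gauss_exp sigma_gt0 theta.
have mE : measurable_fun setT E by exact: measurable_expR_dotr.
have iPE : mu.-integrable setT (fun x : rV => (pert_density x * E x)%:E).
  have := integrableZl measurableT 2 iE; apply: le_integrable => //.
    apply/measurable_EFinP; apply: measurable_funM => //.
    exact: measurable_pert_density.
  move=> x _; rewrite lee_fin [leRHS]ger0_norm; last first.
    by do 2?apply: mulr_ge0; rewrite ?expR_ge0// ltW// gauss_gt0.
  rewrite ger0_norm; last by rewrite mulr_ge0 ?expR_ge0// ltW// pert_density_gt0.
  by rewrite mulrA ler_wpM2r ?expR_ge0// pert_density_le.
have [iP EP] := integrable_pert_density.
have [idt Edt] := Rintegral_dotr theta (fun i => (pert_density_coord i).1)
  (fun i => (pert_density_coord i).2).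
have [igt Egt] := Rintegral_dotr theta (integrable_gauss_coord sigma_gt0)
  (gauss_mean sigma_gt0).
set y := sigma ^+ 2 / 2 * dotr theta theta.
have Eg : \int[mu]_x (gauss sigma x * E x) = expR y.
  by rewrite /Rintegral gauss_mgf.
(* With [u = dotr theta x], the next four facts assemble [2 * gauss * (E - 1 - u) + pert_density *
   (1 + u)], which dominates [pert_density * E] and has integral [2 * expR y - 1]. *)
have [i1 E1] := RintegralZD 1 iP idt.
have [i2 E2] := RintegralZD (- 2) igt i1.
have ig : mu.-integrable setT (fun x : rV => (gauss sigma x)%:E).
  exact: integrable_gauss.
have [i3 E3] := RintegralZD (- 2) ig i2.
have [i4 E4] := RintegralZD 2 iE i3.
have g1 : \int[mu]_x gauss sigma x = 1 by rewrite /Rintegral integral_gauss.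
have := le_Rintegral measurableT iPE i4; rewrite E4 E3 E2 E1 Eg Egt Edt EP g1 => H.
have {H} : \int[mu]_x (pert_density x * E x) <= expR y ^+ 2.
  apply: (le_trans (H _)); last by have := sqr_ge0 (expR y - 1); lra.
  move=> x _; rewrite -/(E x) -subr_ge0.
  rewrite (_ : _ - _ = (2 * gauss sigma x - pert_density x) * (E x - (1 + dotr
    theta x))).
    by rewrite mulr_ge0// subr_ge0 ?pert_density_le ?expR_ge1Dx.
  by ring.
rewrite -expRM_natl mulr2n.
rewrite /Rintegral -lee_fin fineK; last exact: integrable_fin_num.
by move=> /le_trans; apply; rewrite lee_fin ler_expR /y; lra.
Qed.

Lemma mean_pert_density (P : probability rV R) :
  (forall A, measurable A -> P A = (\int[mu]_(x in A) (pert_density x)%:E)%E) ->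
  mean P = 0.
Proof.
move=> PE; apply/rowP => i; rewrite !mxE unlock.
rewrite (integral_density measurable_pert_density (fun x => ltW
  (pert_density_gt0 x)) PE).
  exact: (pert_density_coord i).2.
exact: measurable_row_coord.
Qed.

(** An open set contains a cube of positive volume, on which the density is bounded below; [D]
    bounds the squared norm on that cube. *)
Lemma pert_full_support (P : probability rV R) :
  (forall A, measurable A -> P A = (\int[mu]_(x in A) (pert_density x)%:E)%E) ->
  full_support P.
Proof.
move=> PE U oU [x Ux].
have /nbhs_ballP[e /= e0 sub] : nbhs x U by exact: open_nbhs_nbhs.
pose a (i : 'I_d) := x ord0 i - e / 2; pose b (i : 'I_d) := x ord0 i + e / 2.
have abE i : b i - a i = e by rewrite /a /b; lra.
pose C := [set y : rV | forall i, a i <= y ord0 i <= b i].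
have mC : measurable C by exact: measurable_row_cube.
have CU : C `<=` U.
  move=> y Cy; apply: sub; split => // k i; rewrite ord1 /ball /=.
  by have := Cy i; rewrite /a /b => /andP[? ?]; rewrite ltr_norml; lra.
have muC : mu C = (e ^+ d)%:E by apply: lebesgue_row_cube => //; exact: ltW.
pose D := \sum_(i < d) (`|x ord0 i| + e) ^+ 2.
pose c := gauss_peak (d := d) sigma * expR (- (2 * sigma ^+ 2)^-1 * D) / 2.
have c0 : 0 < c by rewrite divr_gt0// mulr_gt0 ?gauss_peak_gt0 ?expR_gt0.
have cle y : C y -> c <= pert_density y.
  move=> Cy; apply: le_trans (pert_density_ge y); rewrite ler_pM2r//.
  apply: gauss_ge => //; apply: ler_sum => i _;
    rewrite -expr2 -real_normK ?num_real//.
  rewrite lerXn2r ?nnegrE ?addr_ge0 ?(ltW e0)//.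
  have := Cy i; rewrite /a /b => /andP[? ?].
  have -> : y ord0 i = x ord0 i + (y ord0 i - x ord0 i) by ring.
  by apply: (le_trans (ler_normD _ _)); rewrite lerD2l ler_norml; lra.
apply: (@lt_le_trans _ _ (P C)).
  rewrite PE//; apply: (@lt_le_trans _ _ (\int[mu]_(y in C) c%:E)%E).
    rewrite integral_cst// [X in (_ * X)%E](_ : _ = (e ^+ d)%:E)//.
    by rewrite -EFinM lte_fin mulr_gt0// exprn_gt0.
  apply: ge0_le_integral => //.
  - by move=> y _; rewrite lee_fin ltW.
  - by apply/measurable_EFinP; apply: measurable_funTS;
    exact: measurable_pert_density.
apply: le_measure => //; rewrite inE//.
exact: open_measurable_row.
Qed.

(** The link between [sigma] and [alpha] makes the exponent [sigma ^+ 2 * dotr theta theta] of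
    [pert_density_mgf] exactly the subgaussian one, [alpha ^+ 2 * enorm theta ^+ 2 / 2]. *)
Lemma pert_score_class (alpha : R) (P : probability rV R) :
  2 * sigma ^+ 2 = alpha ^+ 2 ->
  (forall A, measurable A -> P A = (\int[mu]_(x in A) (pert_density x)%:E)%E) ->
  score_class alpha lipschitz_cst P pert_density.
Proof.
move=> sa PE; have p0 x := ltW (pert_density_gt0 x).
split.
- exact: pert_full_support.
- by split => //; exact: measurable_pert_density.
- split=> [i|theta].
    apply: (integrable_density measurable_pert_density p0 PE).
      exact: measurable_row_coord.
    exact: (pert_density_coord i).1.
  rewrite mean_pert_density// unlock.
  under eq_integral do rewrite subr0.
  rewrite (integral_density measurable_pert_density p0 PE); last first.
    exact: measurable_expR_dotr.
  apply: (le_trans (pert_density_mgf theta)).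
  by rewrite lee_fin ler_expR enorm_sqr -sa; lra.
- exact: pert_density_gt0.
- by move=> x; apply: has_gradient_differentiable;
  exact: has_gradient_ln_pert_density.
- exact: score_pert_lipschitz.
Qed.

End perturbed_gaussian.

(** * Averaging over the hypercube *)

(* Turns [d.+2] bumps per cell into one perturbation annihilating the [d.+1]
   moments of order at most one. *)
Lemma bounded_kernel_vector (R : realFieldType) (n : nat)
    (a : 'I_n.+1 -> 'I_n -> R) :
  exists p : 'I_n.+1 -> R, [/\ forall c, `|p c| <= 1, exists c, p c = 1 &
    forall l, \sum_c p c * a c l = 0].
Proof.
pose A : 'M[R]_(n.+1, n) := \matrix_(c, l) a c l.
have /rowV0Pn[v /sub_kermxP vA v0] : kermx A != 0.
  rewrite kermx_eq0 /row_free; apply/eqP => rA.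
  by have := rank_leq_col A; rewrite rA ltnn.
have [j vj] : exists j, v ord0 j != 0.
  apply/existsP; apply: contra_neqT v0; rewrite negb_exists => /forallP v0.
  by apply/rowP => j; rewrite mxE; apply/eqP; rewrite -[_ == _]negbK v0.
(* Dividing by the entry of largest modulus bounds every coefficient by 1 and turns this one into
   1. *)
pose c0 := [arg max_(c > j) `|v ord0 c|]%O.
have [vc0 vmax] : v ord0 c0 != 0 /\ forall c, `|v ord0 c| <= `|v ord0 c0|.
  rewrite /c0; case: arg_maxP => // i _ H; split; last by move=> c; exact: H.
  by rewrite -normr_gt0 (lt_le_trans _ (H j isT))// normr_gt0.
exists (fun c => v ord0 c / v ord0 c0); split.
- by move=> c; rewrite normrM normfV ler_pdivrMr ?normr_gt0// mul1r.
- by exists c0; rewrite divff.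
- move=> l; have /rowP/(_ l) := vA; rewrite !mxE => E.
  rewrite (eq_bigr (fun c => (v ord0 c0)^-1 * (v ord0 c * A c l))).
    by rewrite -mulr_sumr E mulr0.
  by move=> c _; rewrite mxE; ring.
Qed.

Section hypercube.
Context {I : finType}.

Definition flip (k : I) (tau : {ffun I -> bool}) : {ffun I -> bool} :=
  [ffun i => if i == k then ~~ tau i else tau i].

Lemma flipK k : involutive (flip k).
Proof.
by move=> tau; apply/ffunP => i; rewrite !ffunE; case: eqP => // _; rewrite negbK.
Qed.

Lemma flip_same k (tau : {ffun I -> bool}) : flip k tau k = ~~ tau k.
Proof. by rewrite ffunE eqxx. Qed.

Lemma flip_other k (tau : {ffun I -> bool}) i : i != k -> flip k tau i = tau i.
Proof. by rewrite ffunE => /negPf ->. Qed.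

(** [flip k] permutes the sign vectors, so [a tau k] and [a (flip k tau) k] have the same average
    over [tau], at least [b / 2]; the uniform bound [S] dominates the average of the sums over
    [k]. *)
Lemma assouad_average_real (R : realFieldType) (a : {ffun I -> bool} -> I -> R)
    (b S : R) :
  (forall tau k, b <= a tau k + a (flip k tau) k) ->
  (forall tau, \sum_k a tau k <= S) -> #|I|%:R * b / 2 <= S.
Proof.
move=> ab aS; pose N : R := #|{ffun I -> bool}|%:R.
have N0 : 0 < N by rewrite ltr0n; apply/card_gt0P; exists [ffun=> true].
have upper : \sum_tau \sum_k a tau k <= N * S.
  apply: (le_trans (ler_sum _ (fun tau _ => aS tau))).
  by rewrite sumr_const mulr_natl.
have lower : #|I|%:R * (N * b / 2) <= \sum_tau \sum_k a tau k.
  rewrite exchange_big /= [leLHS]mulr_natl -sumr_const.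
  apply: ler_sum => k _.
  have E : \sum_tau a tau k = \sum_tau a (flip k tau) k.
    by rewrite (reindex_inj (inv_inj (flipK k))).
  suff : N * b <= \sum_tau a tau k + \sum_tau a tau k by lra.
  rewrite [X in _ <= _ + X]E -big_split /= mulr_natl -sumr_const.
  exact: ler_sum.
rewrite -(ler_pM2l N0); lra.
Qed.

(** Either [S] is infinite and there is nothing to prove, or it forces every term to be finite. *)
Lemma assouad_average (R : realType) (a : {ffun I -> bool} -> I -> \bar R)
    (b : R) (S : \bar R) :
  (forall tau k, 0 <= a tau k)%E ->
  (forall tau k, b%:E <= a tau k + a (flip k tau) k)%E ->
  (forall tau, \sum_k a tau k <= S)%E -> ((#|I|%:R * b / 2)%:E <= S)%E.
Proof.
move=> a0 ab aS.
have S0 : (0 <= S)%E.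
  by apply: le_trans (aS [ffun=> true]); apply: sume_ge0.
case: S S0 aS => [S| |] S0 aS; [|by rewrite leey|by []].
have afin tau k : a tau k \is a fin_num.
  rewrite ge0_fin_numE//; apply: le_lt_trans (ltry S); apply: le_trans (aS tau).
  by rewrite (bigD1 k)//= leeDl// sume_ge0.
rewrite lee_fin; apply: (@assouad_average_real R (fun tau k => fine (a tau k))).
  by move=> tau k; rewrite -lee_fin EFinD !fineK.
move=> tau; rewrite -lee_fin -sumEFin; apply: le_trans (aS tau).
by rewrite le_eqVlt; apply/orP; left; apply/eqP/eq_bigr => k _; rewrite fineK.
Qed.

End hypercube.

(** * Elementary estimates for the choice of the grid *)

Lemma expR_half_le2 (R : realType) : expR (1 / 2 : R) <= 2.
Proof.
have := expR_ge1Dx (- (1 / 2) : R); rewrite expRN => h.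
by rewrite -[leLHS]invrK invf_ple ?posrE ?invr_gt0 ?expR_gt0//; lra.
Qed.

(** [(1 + x) ^+ n <= expR (n%:R * x)]. With [x] the chi-square divergence of one observation, the
    value 2 leaves the factor [1 - 2 / 4] in the two-point bound. *)
Lemma exp1Dinv_le2 (R : realType) (n : nat) (x : R) : (0 < n)%N ->
  0 <= x -> x <= (1 / 2) / n%:R -> (1 + x) ^+ n <= 2.
Proof.
move=> n0 x0 xn; apply: le_trans (expR_half_le2 R).
have -> : (1 / 2 : R) = n%:R * ((1 / 2) / n%:R).
  by field; rewrite pnatr_eq0 -lt0n.
rewrite expRM_natl lerXn2r ?nnegrE ?expR_ge0 ?addr_ge0//.
by apply: le_trans (expR_ge1Dx x) _; rewrite ler_expR.
Qed.

(** [m] is the least integer with [n <= m ^ p]. Minimality gives [m.-1 ^ p < n], and [m <= 2 * m.-1]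
    once [m] exceeds 1, so [m] is at most twice the [p]-th root of [n]. *)
Lemma root_approximation (R : realType) (n p : nat) : (0 < n)%N -> (0 < p)%N ->
  exists m : nat, [/\ (0 < m)%N, (n <= m ^ p)%N &
    4^-1 * n%:R `^ (- (2 / p%:R)) <= m%:R ^- 2 :> R].
Proof.
move=> n0 p0.
have ex : exists m, (n <= m ^ p)%N.
  by exists n; rewrite -[X in (X <= _)%N]expn1 leq_pexp2l.
case: (ex_minnP ex) => m nm mmin.
have m0 : (0 < m)%N.
  by rewrite lt0n; apply/eqP => m0; move: nm; rewrite m0 exp0n// leqNgt n0.
exists m; split => //.
have mn : (m ^ p <= 2 ^ p * n)%N.
  have [->|m1] := eqVneq m 1%N; first by rewrite exp1n muln_gt0 expn_gt0 n0.
  have h : (m.-1 ^ p < n)%N.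
    rewrite ltnNge; apply/negP => /mmin; rewrite leqNgt => /negP; apply.
    by rewrite prednK.
  apply: leq_trans (_ : (2 * m.-1) ^ p <= _)%N; last first.
    by rewrite expnMn leq_mul2l (ltnW h) orbT.
  rewrite leq_exp2r//; move: m0 m1; case: (m) => // -[|k] // _ _.
  by rewrite /= mul2n -addnn addSn ltnS leq_addl.
have mR : (m%:R : R) <= 2 * n%:R `^ (p%:R^-1).
  have -> : (m%:R : R) = (m%:R `^ p%:R) `^ (p%:R^-1).
    by rewrite -powRrM divff ?powRr1 ?pnatr_eq0 ?gtn_eqF.
  have -> : (2 : R) = (2 `^ p%:R) `^ (p%:R^-1).
    by rewrite -powRrM divff ?powRr1 ?pnatr_eq0 ?gtn_eqF.
  rewrite -powRM ?powR_ge0//; apply: ge0_ler_powR;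
    rewrite ?nnegrE ?mulr_ge0 ?powR_ge0//.
  by rewrite !powR_mulrn// -!natrX -natrM ler_nat.
have x0 : 0 < n%:R `^ (p%:R^-1) :> R by apply: powR_gt0; rewrite ltr0n.
have -> : n%:R `^ (- (2 / p%:R)) = ((n%:R `^ (p%:R^-1)) ^+ 2)^-1 :> R.
  by rewrite powRN -powR_mulrn ?powR_ge0// -powRrM [p%:R^-1 * _]mulrC.
rewrite -invfM lef_pV2 ?posrE ?mulr_gt0 ?exprn_gt0 ?ltr0n//.
have -> : 4 * (n%:R `^ p%:R^-1) ^+ 2 = (2 * n%:R `^ p%:R^-1) ^+ 2 :> R by ring.
by rewrite lerXn2r ?nnegrE ?mulr_ge0 ?powR_ge0.
Qed.

(** * Risk over a hypercube of densities *)

Section hypercube_family.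
Context {R : realType} {d : nat} {I C : finType}.
Local Notation rV := ('rV[R]_d).
Local Notation mu := (@lebesgue_row R d).
Variables (sigma r eps : R) (z : I * C -> rV) (p : I -> C -> R) (c0 : I -> C).
Hypotheses (sigma_gt0 : 0 < sigma) (r_gt0 : 0 < r) (r_le1 : r <= 1).
Hypotheses (eps_gt0 : 0 < eps) (eps_le : eps <= 1 / 2).
Hypothesis p_le1 : forall k c, `|p k c| <= 1.
Hypothesis p_c0 : forall k, p k (c0 k) = 1.
Hypothesis caps_disjoint : forall x, at_most_one (fun j => cap r (z j) x).
Hypothesis z_bounds : forall j i, 0 <= z j ord0 i <= 1.
Implicit Types (tau : {ffun I -> bool}) (k : I).

(** All bumps of a cell share its sign, so the moment identities of the cell survive every choice of
    signs. *)
Definition weight tau (j : I * C) : R := (-1) ^+ tau j.1 * p j.1 j.2.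

Local Notation dens tau := (pert_density sigma r eps z (weight tau)).
Local Notation per tau := (pert r eps z (weight tau)).

Lemma weight_le1 tau j : `|weight tau j| <= 1.
Proof. by rewrite normrM normrX normrN1 expr1n mul1r. Qed.

Lemma weight_moment tau (h : I * C -> R) :
  (forall k, \sum_c p k c * h (k, c) = 0) -> \sum_j weight tau j * h j = 0.
Proof.
move=> h0.
rewrite (eq_bigr (fun j => weight tau (j.1, j.2) * h (j.1, j.2))); last by case.
rewrite -(pair_bigA _ (fun k c => weight tau (k, c) * h (k, c)))/=.
rewrite big1// => k _.
rewrite (eq_bigr (fun c => (-1) ^+ tau k * (p k c * h (k, c)))).
  by rewrite -mulr_sumr h0 mulr0.
by move=> c _; rewrite mulrA.
Qed.

(** Circumscribes the support of a bump centred at [x]; unlike the ball it has an immediate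
    volume. *)
Definition cube (x : rV) : set rV :=
  [set y | forall i, x ord0 i - r <= y ord0 i <= x ord0 i + r].

Lemma measurable_cube x : measurable (cube x).
Proof. exact: measurable_row_cube. Qed.

Lemma lebesgue_cube x : mu (cube x) = ((2 * r) ^+ d)%:E.
Proof.
apply: lebesgue_row_cube => [i|]; first by ring.
by rewrite mulr_ge0// ltW.
Qed.

Lemma cap_cube x j : cap r (z j) x != 0 -> cube (z j) x.
Proof.
move=> /(cap_neq0 r_gt0) h i; have := le_lt_trans (coord_le_enorm _ i) h.
by rewrite !mxE ltr_norml => /andP[? ?]; apply/andP; split; lra.
Qed.

(** Away from the bumps of cell [k] the flip changes nothing; on them both perturbations are at most
    [eps * r ^+ 2] in modulus. *)
Lemma per_flip_sqr tau k x :
  (per (flip k tau) x - per tau x) ^+ 2 <=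
  4 * eps ^+ 2 * r ^+ 4 * \sum_c \1_(cube (z (k, c))) x.
Proof.
have S0 : 0 <= \sum_c \1_(cube (z (k, c))) x :> R by exact: sumr_ge0.
have [/existsP[c hc]|] := boolP [exists c, cap r (z (k, c)) x != 0].
  have S1 : 1 <= \sum_c \1_(cube (z (k, c))) x :> R.
    rewrite (bigD1 c)//= indicE mem_set ?lerDl ?sumr_ge0//.
    exact: cap_cube.
  have h1 := pert_norm r_gt0 eps_gt0 (weight_le1 (flip k tau)) caps_disjoint x.
  have h2 := pert_norm r_gt0 eps_gt0 (weight_le1 tau) caps_disjoint x.
  apply: (@le_trans _ _ (4 * eps ^+ 2 * r ^+ 4)); last first.
    by rewrite ler_peMr// !mulr_ge0 ?exprn_ge0 ?(ltW r_gt0) ?(ltW eps_gt0).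
  have -> : 4 * eps ^+ 2 * r ^+ 4 = (2 * (eps * r ^+ 2)) ^+ 2 by ring.
  rewrite -real_normK ?num_real// lerXn2r ?nnegrE ?normr_ge0//.
    by rewrite !mulr_ge0 ?(ltW r_gt0) ?(ltW eps_gt0).
  by apply: (le_trans (ler_normB _ _)); lra.
rewrite negb_exists => /forallP c1.
have -> : per (flip k tau) x = per tau x.
  congr (_ * _); apply: eq_bigr => -[i c] _; rewrite /weight /=.
  have [->|ik] := eqVneq i k; last by rewrite flip_other.
  by have := c1 c; rewrite negbK => /eqP ->; rewrite expr0n !mulr0.
by rewrite subrr expr0n /= !mulr_ge0 ?exprn_ge0 ?(ltW r_gt0) ?(ltW eps_gt0).
Qed.

(** The bound of [per_flip_sqr] times 2 for the denominator [1 + per tau x >= 1 / 2], times the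
    maximum of the Gaussian density and the total volume of the cubes of one cell. *)
Definition chi2_bound : R :=
  8 * eps ^+ 2 * r ^+ 4 * gauss_peak (d := d) sigma * #|C|%:R * (2 * r) ^+ d.

Let dens_gt0 tau x : 0 < dens tau x.
Proof. exact: pert_density_gt0 (weight_le1 _) _ _. Qed.

Let mdens tau : measurable_fun setT (dens tau).
Proof. exact: measurable_pert_density. Qed.

(** The chi-square identity [q ^+ 2 / p + p = 2 * q + (q - p) ^+ 2 / p], arranged so that both sides
    are nonnegative and can be integrated without integrability conditions. *)
Lemma dens_flip_ratio tau k x :
  dens (flip k tau) x ^+ 2 / dens tau x + dens tau x <=
  2 * dens (flip k tau) x +
  8 * eps ^+ 2 * r ^+ 4 * gauss_peak (d := d) sigma * \sum_c \1_(cube (z (k, c))) x.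
Proof.
have d0 := dens_gt0 tau x.
have E : dens (flip k tau) x ^+ 2 / dens tau x + dens tau x =
    2 * dens (flip k tau) x +
    gauss sigma x * (per (flip k tau) x - per tau x) ^+ 2 / (1 + per tau x).
  have := pert_bounds r_gt0 r_le1 eps_gt0 eps_le (weight_le1 tau) caps_disjoint x.
  move: d0; rewrite /pert_density => d0 /andP[b1 b2].
  by field; rewrite !gt_eqF ?gauss_gt0//; lra.
rewrite E lerD2l.
have /andP[b1 _] := pert_bounds r_gt0 r_le1 eps_gt0 eps_le (weight_le1 tau)
  caps_disjoint x.
have g0 : 0 < gauss sigma x by exact: gauss_gt0.
have b0 : 0 < 1 + per tau x by lra.
rewrite ler_pdivrMr//.
have h := per_flip_sqr tau k x.
set S := \sum_c _ in h *; set D := (_ - _) ^+ 2 in h *.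
have D0 : 0 <= D by exact: sqr_ge0.
have gp := gauss_le_peak sigma_gt0 x.
have e1 : gauss sigma x * D <= gauss_peak (d := d) sigma * (4 * eps ^+ 2 * r ^+
  4 * S).
  by rewrite ler_pM// ltW.
apply: (le_trans e1).
have Y0 : 0 <= gauss_peak (d := d) sigma * (4 * eps ^+ 2 * r ^+ 4 * S).
  by apply: le_trans e1; rewrite mulr_ge0// ltW.
have : 0 <= gauss_peak (d := d) sigma * (4 * eps ^+ 2 * r ^+ 4 * S) * (1 + per
  tau x - 1 / 2).
  by rewrite mulr_ge0// subr_ge0.
lra.
Qed.

Hypothesis p_mass : forall k, \sum_c p k c *
  \int[mu]_x (gauss sigma x * 1 * cap r (z (k, c)) x ^+ 2) = 0.

Let weight_mass tau : \sum_j weight tau j *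
  \int[mu]_x (gauss sigma x * 1 * cap r (z j) x ^+ 2) = 0.
Proof.
exact: (weight_moment
  (h := fun j => \int[mu]_x (gauss sigma x * 1 * cap r (z j) x ^+ 2)) tau p_mass).
Qed.

Lemma integral_dens tau : (\int[mu]_x (dens tau x)%:E = 1)%E.
Proof.
exact: (integral_pert_density eps sigma_gt0 (weight_mass tau)).
Qed.

Lemma continuous_dens_ratio tau k :
  continuous (fun x => dens (flip k tau) x ^+ 2 / dens tau x).
Proof.
move=> x; apply: differentiable_continuous.
have h t := differentiable_pert_density sigma r eps z (weight t) x.
apply: (@differentiableM _ _ (fun y => dens (flip k tau) y ^+ 2) (fun y =>
  (dens tau y)^-1)).
  exact: (@differentiableM _ _ (dens (flip k tau)) (dens (flip k tau)) x (h _)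
    (h _)).
by apply: differentiableV; rewrite ?gt_eqF.
Qed.

Lemma chi2_dens tau k :
  (\int[mu]_x (dens (flip k tau) x ^+ 2 / dens tau x)%:E <= (1 + chi2_bound)%:E)%E.
Proof.
set K := 8 * eps ^+ 2 * r ^+ 4 * gauss_peak (d := d) sigma.
have K0 : 0 <= K.
  rewrite mulr_ge0 ?(ltW (gauss_peak_gt0 sigma_gt0))//.
  by rewrite !mulr_ge0 ?exprn_ge0 ?(ltW r_gt0) ?(ltW eps_gt0).
have q0 x : 0 <= dens (flip k tau) x ^+ 2 / dens tau x.
  by rewrite divr_ge0 ?sqr_ge0// ltW.
have mq : measurable_fun setT (fun x => dens (flip k tau) x ^+ 2 / dens tau x).
  exact: continuous_measurable_row (@continuous_dens_ratio tau k).
pose S (x : rV) : R := \sum_c \1_(cube (z (k, c))) x.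
have mS : measurable_fun setT S.
  by apply: measurable_sum => c; apply: measurable_indic; exact: measurable_cube.
have S0 x : 0 <= S x by exact: sumr_ge0.
have intS : (\int[mu]_x (S x)%:E = (#|C|%:R * (2 * r) ^+ d)%:E)%E.
  under eq_integral do rewrite /S -sumEFin.
  rewrite ge0_integral_sum//.
  - rewrite (eq_bigr (fun=> ((2 * r) ^+ d)%:E)).
      by rewrite sumEFin sumr_const -[X in X%:E = _]mulr_natl.
    move=> c _; rewrite integral_indic//; last exact: measurable_cube.
    by rewrite setIT; exact: lebesgue_cube.
  - by move=> c; apply/measurable_EFinP; apply: measurable_indic;
    exact: measurable_cube.
(* The subtracted 1 moves to the left as the integral of [dens tau], which yields the form of
   [dens_flip_ratio]. *)
have -> : (1 + chi2_bound)%:E = ((2 + K * (#|C|%:R * (2 * r) ^+ d))%:E - 1)%E.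
  by rewrite -EFinB; congr EFin; rewrite /chi2_bound -/K; ring.
rewrite leeBrDr// -[X in (_ + X <= _)%E](integral_dens tau) -ge0_integralD//;
  last 4 first.
- by move=> x _; rewrite lee_fin.
- exact/measurable_EFinP.
- by move=> x _; rewrite lee_fin ltW.
- exact/measurable_EFinP.
apply: (@le_trans _ _ (\int[mu]_x ((2 * dens (flip k tau) x)%:E + (K * S x)%:E))%E).
  apply: ge0_le_integral => //.
  - by move=> x _; rewrite adde_ge0// lee_fin// ltW.
  - by apply: emeasurable_funD; exact/measurable_EFinP.
  - by apply: emeasurable_funD; apply/measurable_EFinP; exact: measurable_funM.
  - by move=> x _; rewrite -!EFinD lee_fin; exact: dens_flip_ratio.
rewrite ge0_integralD//; last 4 first.
- by move=> x _; rewrite lee_fin mulr_ge0// ltW.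
- by apply/measurable_EFinP; exact: measurable_funM.
- by move=> x _; rewrite lee_fin mulr_ge0.
- by apply/measurable_EFinP; exact: measurable_funM.
under eq_integral do rewrite EFinM.
rewrite ge0_integralZl_EFin//; last 2 first.
- by move=> x _; rewrite lee_fin ltW.
- exact/measurable_EFinP.
rewrite integral_dens mule1.
under eq_integral do rewrite EFinM.
rewrite ge0_integralZl_EFin//; last 2 first.
- by move=> x _; rewrite lee_fin.
- exact/measurable_EFinP.
by rewrite intS -EFinM -EFinD.
Qed.

(** * Separation of the scores on off-centre boxes *)

Hypothesis d_gt0 : (0 < d)%N.

Local Notation zc k := (z (k, c0 k)).

(** The upper ends keep [x] within [r / 2] of the centre, where the bump is high; the lower ends
    keep every partial derivative of the bump away from 0. *)
Definition box k : set rV := [set x | forall i,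
  zc k ord0 i + r / (4 * d%:R) <= x ord0 i <= zc k ord0 i + r / (2 * d%:R)].

Let dR_gt0 : 0 < d%:R :> R. Proof. by rewrite ltr0n. Qed.

Lemma measurable_box k : measurable (box k).
Proof. exact: measurable_row_cube. Qed.

Lemma lebesgue_box k : mu (box k) = ((r / (4 * d%:R)) ^+ d)%:E.
Proof.
apply: lebesgue_row_cube => [i|]; last
  by rewrite divr_ge0 ?(ltW r_gt0) ?mulr_ge0 ?(ltW dR_gt0).
by field; rewrite gt_eqF.
Qed.

Lemma box_cap k x : box k x -> r ^+ 2 / 2 <= cap r (zc k) x.
Proof.
move=> xk; rewrite /cap le_max; apply/orP; right.
have h : dotr (x - zc k) (x - zc k) <= d%:R * (r / (2 * d%:R)) ^+ 2.
  rewrite /dotr mulr_natl -[X in _ *+ X](card_ord d) -sumr_const.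
  apply: ler_sum => i _; rewrite -expr2 lerXn2r ?nnegrE//.
  - have /andP[h _] := xk i; rewrite !mxE subr_ge0 (le_trans _ h)// lerDl.
    by rewrite divr_ge0 ?(ltW r_gt0) ?mulr_ge0 ?(ltW dR_gt0).
  - by rewrite divr_ge0 ?(ltW r_gt0) ?mulr_ge0 ?(ltW dR_gt0).
  - by have /andP[_ h] := xk i; rewrite !mxE lerBlDl.
have : d%:R * (r / (2 * d%:R)) ^+ 2 <= r ^+ 2 / 4.
  have -> : d%:R * (r / (2 * d%:R)) ^+ 2 = r ^+ 2 / 4 * d%:R^-1.
    by field; rewrite gt_eqF.
  by rewrite ler_piMr ?divr_ge0 ?sqr_ge0// invf_le1// ler1n.
have := sqr_ge0 r; lra.
Qed.

Let box_cap_gt0 k x : box k x -> cap r (zc k) x != 0.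
Proof.
move=> /box_cap h; rewrite gt_eqF// (lt_le_trans _ h)//.
by rewrite divr_gt0// exprn_gt0.
Qed.

Lemma box_cap_other k x j : box k x -> j != (k, c0 k) -> cap r (z j) x = 0.
Proof.
move=> xk jk; case: (caps_disjoint x jk) => // h.
by have := box_cap_gt0 xk; rewrite h eqxx.
Qed.

Lemma box_sum k x (h : I * C -> R) tau : box k x ->
  (forall j, cap r (z j) x = 0 -> h j = 0) ->
  \sum_j weight tau j * h j = (-1) ^+ tau k * h (k, c0 k).
Proof.
move=> xk h0; rewrite (bigD1 (k, c0 k))//= big1 ?addr0.
  by rewrite /weight p_c0 mulr1.
by move=> j jk; rewrite h0 ?mulr0//; exact: box_cap_other xk jk.
Qed.

Lemma box_disjoint k l x : box k x -> box l x -> k = l.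
Proof.
move=> xk xl; apply/eqP; apply: contraT => kl.
have : (l, c0 l) != (k, c0 k) by apply: contra kl => /eqP[->].
by move=> /(box_cap_other xk) h; have := box_cap_gt0 xl; rewrite h eqxx.
Qed.

(** The centres lie in the unit cube and [r / (2 * d%:R)] is at most 1, so the coordinates of [x]
    lie in [[0, 2]] and its squared norm is at most [4 * d%:R], uniformly in the cell. *)
Lemma box_dens_ge tau k x : box k x ->
  gauss_peak (d := d) sigma * expR (- (2 * sigma ^+ 2)^-1 * (4 * d%:R)) / 2 <=
    dens tau x.
Proof.
move=> xk; apply: le_trans (pert_density_ge sigma_gt0 r_gt0 r_le1 eps_gt0 eps_le
  (weight_le1 tau) caps_disjoint x).
rewrite ler_pM2r//; apply: gauss_ge => //.
rewrite mulr_natr -[X in _ *+ X](card_ord d) -sumr_const; apply: ler_sum => i _.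
have rd : r / (2 * d%:R) <= 1.
  rewrite ler_pdivrMr ?mulr_gt0// mul1r (le_trans r_le1)//.
  have : 1 <= d%:R :> R by rewrite ler1n.
  by lra.
have rd0 : 0 <= r / (4 * d%:R) by rewrite divr_ge0 ?(ltW r_gt0) ?mulr_ge0 ?(ltW
  dR_gt0).
have /andP[h1 h2] := xk i; have /andP[b1 b2] := z_bounds (k, c0 k) i.
have x0 : 0 <= x ord0 i by lra.
have x2 : x ord0 i <= 2 by lra.
by nra.
Qed.

(* On the box only the bump [(k, c0 k)] is active: with value [v] and partial
   derivative [g] there, the two scores differ by [2 g / (1 - v ^ 2)]. *)
Lemma box_score_separation tau k x (i : 'I_d) (a : R) : box k x ->
  eps ^+ 2 * r ^+ 2 / (2 * d%:R ^+ 2) <=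
  (a - score (dens tau) x ord0 i) ^+ 2 +
  (a - score (dens (flip k tau)) x ord0 i) ^+ 2.
Proof.
move=> xk.
have cE t := score_pert_density_coord sigma_gt0 r_gt0 r_le1 eps_gt0 eps_le
  (weight_le1 t) caps_disjoint x i.
rewrite !cE; set s0 := - (sigma ^+ 2)^-1 * x ord0 i.
have perE t : per t x = (-1) ^+ t k * (eps / r ^+ 2 * cap r (zc k) x ^+ 2).
  rewrite /pert (box_sum (h := fun j => cap r (z j) x ^+ 2) t xk); first by ring.
  by move=> j ->; rewrite expr0n.
have gradE t : pert_grad r eps z (weight t) x ord0 i =
    (-1) ^+ t k * (- 4 * (eps / r ^+ 2) * (cap r (zc k) x * (x - zc k) ord0 i)).
  rewrite pert_grad_coord (box_sum (h := fun j => cap r (z j) x * (x - z j)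
    ord0 i) t xk).
    by ring.
  by move=> j ->; rewrite mul0r.
have /andP[] := pert_bounds r_gt0 r_le1 eps_gt0 eps_le (weight_le1 tau)
  caps_disjoint x.
rewrite !perE !gradE flip_same.
set u := eps / r ^+ 2 * _; set g := - 4 * _ * _.
(* On the box the cap is at least [r ^+ 2 / 2] and the offset from the centre at least
   [r / (4 * d%:R)], so [- g >= eps * r / (2 * d%:R)]. *)
have g2 : eps ^+ 2 * r ^+ 2 / (2 * d%:R ^+ 2) <= 2 * g ^+ 2.
  have y0 : r / (4 * d%:R) <= (x - zc k) ord0 i.
    by have /andP[h _] := xk i; rewrite !mxE lerBrDl.
  have rd0 : 0 <= r / (4 * d%:R) by rewrite divr_ge0 ?(ltW r_gt0) ?mulr_ge0
    ?(ltW dR_gt0).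
  have h : eps * r / (2 * d%:R) <= - g.
    have -> : eps * r / (2 * d%:R) =
        4 * (eps / r ^+ 2) * (r ^+ 2 / 2 * (r / (4 * d%:R))).
      by field; rewrite !gt_eqF.
    rewrite /g !mulNr opprK ler_wpM2l//.
      by rewrite mulr_ge0// divr_ge0 ?exprn_ge0 ?ltW.
    by rewrite ler_pM ?box_cap// divr_ge0 ?exprn_ge0 ?ltW.
  have -> : eps ^+ 2 * r ^+ 2 / (2 * d%:R ^+ 2) = 2 * (eps * r / (2 * d%:R)) ^+ 2.
    by field; rewrite gt_eqF.
  rewrite ler_pM2l// -[X in _ <= X]sqrrN lerXn2r ?nnegrE//.
    by rewrite divr_ge0 ?mulr_ge0 ?ltW.
  by rewrite (le_trans _ h)// divr_ge0 ?mulr_ge0 ?ltW.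
move=> u1 u2; apply: (le_trans g2).
move: u g s0 {g2 perE gradE} u1 u2 => u g s0 u1 u2.
(* The estimate [a] is eliminated by [(B - A) ^+ 2 <= 2 * (A ^+ 2 + B ^+ 2)], where [B - A] is the
   difference of the two scores. *)
have key (v w : R) : 1 / 2 <= 1 + v -> 1 + v <= 3 / 2 ->
    2 * w ^+ 2 <= (a - (s0 + (1 + v)^-1 * w)) ^+ 2 + (a - (s0 - (1 - v)^-1 *
      w)) ^+ 2.
  move=> v1 v2.
  have p1 : 0 < 1 + v by lra.
  have p2 : 0 < 1 - v by lra.
  have p3 : 0 < (1 + v) * (1 - v) by rewrite mulr_gt0.
  set A := a - _; set B := a - _.
  have BA : B - A = 2 * w * ((1 + v) * (1 - v))^-1.
    by rewrite /A /B; field; rewrite !gt_eqF.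
  have inv1 : 1 <= ((1 + v) * (1 - v))^-1.
    by rewrite -[leLHS]invr1 lef_pV2 ?posrE//; have := sqr_ge0 v; lra.
  have h : 4 * w ^+ 2 <= (B - A) ^+ 2.
    rewrite BA exprMn; have -> : (2 * w) ^+ 2 = 4 * w ^+ 2 by ring.
    by rewrite ler_peMr ?exprn_ege1// mulr_ge0// sqr_ge0.
  by have := sqr_ge0 (A + B); lra.
case: (tau k) u1 u2; rewrite /= ?expr0 ?expr1 ?mulN1r ?mul1r ?mulrN => u1 u2.
- rewrite -sqrrN; have := key (- u) (- g); rewrite mulrN mulrN !opprK.
  by apply; lra.
- by apply: key; lra.
Qed.

Section risk.
Variables (n : nat) (P : {ffun I -> bool} -> probability rV R).
Hypothesis PE : forall tau A, measurable A ->
  P tau A = (\int[mu]_(x in A) (dens tau x)%:E)%E.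
Variable s : n.-tuple rV * rV -> rV.
Hypothesis ms : measurable_fun setT s.
Hypothesis chi2_le : (1 + chi2_bound) ^+ n <= 2.

Definition dens_lower_bound : R :=
  gauss_peak (d := d) sigma * expR (- (2 * sigma ^+ 2)^-1 * (4 * d%:R)) / 2.

Definition separation : R :=
  eps ^+ 2 * r ^+ 2 / (2 * d%:R ^+ 2) * (r / (4 * d%:R)) ^+ d.

Let i0 : 'I_d := Ordinal d_gt0.

(** One coordinate suffices: its square is at most the squared Euclidean error, and every partial
    derivative of the bump is bounded below on the box. *)
Let err tau (y : n.-tuple rV * rV) : R :=
  (s y ord0 i0 - score (dens tau) y.2 ord0 i0) ^+ 2.

Let mdiff tau i : measurable_fun setT (fun y : n.-tuple rV * rV =>
  s y ord0 i - score (dens tau) y.2 ord0 i).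
Proof.
apply: measurable_funB.
  exact: (measurableT_comp (@measurable_row_coord _ _ d i) ms).
have h := measurable_score_pert_coord sigma_gt0 r_gt0 r_le1 eps_gt0 eps_le
  (weight_le1 tau) caps_disjoint i.
exact: (measurableT_comp h measurable_snd).
Qed.

Let err_box tau k (y : n.-tuple rV * rV) : R := err tau y * \1_(box k) y.2.

Let merr_box tau k : measurable_fun setT (EFin \o err_box tau k).
Proof.
apply/measurable_EFinP; apply: measurable_funM.
  by apply: measurable_funX; exact: mdiff.
have h : measurable_fun setT (\1_(box k) : rV -> R).
  exact: measurable_indic (measurable_box k).
exact: (measurableT_comp h measurable_snd).
Qed.

Let err_box_ge0 tau k y : (0 <= (EFin \o err_box tau k) y)%E.
Proof. by rewrite /= lee_fin mulr_ge0 ?sqr_ge0. Qed.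

(** Integrated against Lebesgue measure, so that the errors at [tau] and [flip k tau] add under one
    integral; the density reappears as the constant [dens_lower_bound]. *)
Let A tau k (X : n.-tuple rV) : \bar R := (\int[mu]_x (err_box tau k (X, x))%:E)%E.

Let mA tau k : measurable_fun setT (A tau k).
Proof.
exact: (measurable_fun_fubini_tonelli_F _ (merr_box tau k) (err_box_ge0 tau k)).
Qed.

Let A_ge0 tau k X : (0 <= A tau k X)%E.
Proof. by apply: integral_ge0 => x _; exact: err_box_ge0. Qed.

Let merr_slice tau k X : measurable_fun setT (fun x => (err_box tau k (X, x))%:E).
Proof. exact: (measurableT_comp (merr_box tau k) (measurable_pair1 X)). Qed.

Let A_pair tau k X : (separation%:E <= A tau k X + A (flip k tau) k X)%E.
Proof.
rewrite -ge0_integralD//; last first.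
  by move=> x _; exact: (err_box_ge0 (flip k tau) k (X, x)).
  by move=> x _; exact: (err_box_ge0 tau k (X, x)).
have mbox := measurable_box k.
have -> : separation%:E =
    (\int[mu]_x ((eps ^+ 2 * r ^+ 2 / (2 * d%:R ^+ 2))%:E * (\1_(box k) x)%:E))%E.
  rewrite ge0_integralZl_EFin//; last 2 first.
  - by apply/measurable_EFinP; exact: measurable_indic.
  - by rewrite divr_ge0 ?mulr_ge0 ?exprn_ge0 ?ler0n// ltW.
  rewrite integral_indic// setIT /separation EFinM; congr (_ * _)%E.
  by rewrite -(lebesgue_box k).
apply: ge0_le_integral => //.
- move=> x _; rewrite -EFinM lee_fin mulr_ge0//.
  by rewrite divr_ge0 ?mulr_ge0 ?exprn_ge0 ?ler0n// ltW.
- by apply: emeasurable_funM => //; apply/measurable_EFinP; exact: measurable_indic.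
- by apply: emeasurable_funD; exact: merr_slice.
move=> x _; rewrite -EFinM -EFinD lee_fin /err_box -mulrDl /= indicE.
have [/set_mem xk|_] := boolP (x \in box k); last by rewrite !mulr0.
by rewrite !mulr1; exact: box_score_separation.
Qed.

(** The boxes are disjoint, so each point contributes its error to at most one cell. *)
Let loss_ge tau X :
  (\sum_k dens_lower_bound%:E * A tau k X <= score_loss (fun x => s (X, x))
    (dens tau))%E.
Proof.
have c1 : 0 <= dens_lower_bound.
  by rewrite divr_ge0// mulr_ge0 ?expR_ge0// ltW// gauss_peak_gt0.
rewrite (eq_bigr (fun k => \int[mu]_x (dens_lower_bound%:E * (err_box tau k (X,
  x))%:E))%E);
  last first.
  move=> k _; rewrite ge0_integralZl_EFin//.
  by move=> x _; exact: (err_box_ge0 tau k (X, x)).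
rewrite -ge0_integral_sum//; last 2 first.
- by move=> k; apply: emeasurable_funM => //; exact: merr_slice.
- by move=> k x _; rewrite mule_ge0 ?lee_fin//; exact: (err_box_ge0 tau k (X, x)).
apply: ge0_le_integral => //.
- move=> x _; apply: sume_ge0 => k _.
  by rewrite mule_ge0 ?lee_fin//; exact: (err_box_ge0 tau k (X, x)).
- by apply: emeasurable_sum => k; apply: emeasurable_funM => //; exact: merr_slice.
- apply/measurable_EFinP; apply: measurable_funM => //.
  under eq_fun do rewrite enorm_sqr /dotr.
  apply: measurable_sum => i.
  rewrite (_ : (fun x => _) = fun x =>
    (fun y : n.-tuple rV * rV => (s y ord0 i - score (dens tau) y.2 ord0 i) ^+
      2) (X, x)).
    have h : measurable_fun setT (fun y : n.-tuple rV * rV =>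
      (s y ord0 i - score (dens tau) y.2 ord0 i) ^+ 2).
      by apply: measurable_funX; exact: mdiff.
    exact: (measurableT_comp h (measurable_pair1 X)).
  by apply/funext => x /=; rewrite mxE [X in _ + X]mxE expr2.
move=> x _; rewrite (eq_bigr (fun k => (dens_lower_bound * err_box tau k (X,
  x))%:E))//.
rewrite sumEFin lee_fin /err_box /=.
have e1 : err tau (X, x) <= enorm (s (X, x) - score (dens tau) x) ^+ 2.
  rewrite /err -real_normK ?num_real// lerXn2r ?nnegrE ?enorm_ge0//.
  have := coord_le_enorm (s (X, x) - score (dens tau) x) i0.
  by rewrite mxE [X in _ + X]mxE.
have [/existsP[k /asboolP xk]|] := boolP [exists k, `[< box k x >]].
  rewrite (bigD1 k)//= big1 ?addr0.
    rewrite indicE mem_set// mulr1 mulrC ler_pM ?sqr_ge0//.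
    exact: box_dens_ge xk.
  move=> l lk; rewrite indicE memNset ?mulr0// => xl.
  by move: lk; rewrite (box_disjoint xk xl) eqxx.
rewrite negb_exists => /forallP h; rewrite big1.
  by apply: mulr_ge0; [exact: sqr_ge0|exact: ltW].
move=> k _.
by rewrite indicE memNset ?mulr0// => /asboolP; exact/negP/h.
Qed.

Lemma risk_lower_bound (S : \bar R) :
  (forall tau, (score_risk s (P tau) (dens tau) <= S)%E) ->
  ((#|I|%:R * (dens_lower_bound * (separation / 2)) / 2)%:E <= S)%E.
Proof.
move=> HS.
have c1 : 0 <= dens_lower_bound.
  by rewrite divr_ge0// mulr_ge0 ?expR_ge0// ltW// gauss_peak_gt0.
have sep0 : 0 <= separation.
  by rewrite mulr_ge0 ?exprn_ge0 ?divr_ge0 ?mulr_ge0 ?exprn_ge0 ?ler0n// ltW.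
have iA0 tau k : (0 <= \int[power_measure (P tau) n]_X A tau k X)%E.
  exact: integral_ge0.
apply: (assouad_average
  (a := fun tau k => (dens_lower_bound%:E * \int[power_measure (P tau) n]_X A
    tau k X)%E)).
- by move=> tau k; rewrite mule_ge0// lee_fin.
- move=> tau k; rewrite -ge0_muleDr//.
  rewrite EFinM; apply: lee_wpmul2l; first by rewrite lee_fin.
  (* By [chi2_le] the bracket is at least 1/2, the source of [separation / 2]; the other division by
     2 comes from averaging over flips. *)
  apply: (@le_trans _ _ (separation * (1 - (1 + chi2_bound) ^+ n / 4))%:E).
    by rewrite lee_fin ler_wpM2l//; move: chi2_le; lra.
  apply: (two_point_lower_bound (mdens tau) (mdens (flip k tau)) _
    (dens_gt0 tau) (fun x => ltW (dens_gt0 (flip k tau) x)) (PE tau) (PE (flip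
      k tau))) => //.
  - exact: continuous_measurable_row (@continuous_dens_ratio tau k).
  - exact: chi2_dens.
- move=> tau; apply: le_trans (HS tau).
  rewrite (eq_bigr (fun k => \int[power_measure (P tau) n]_X
    (dens_lower_bound%:E * A tau k X))%E);
    last first.
    by move=> k _; rewrite ge0_integralZl_EFin.
  rewrite -ge0_integral_sum//; last 2 first.
  - by move=> k; apply: emeasurable_funM.
  - by move=> k X _; rewrite mule_ge0// lee_fin.
  apply: ge0_le_integral => //.
  - by move=> X _; apply: sume_ge0 => k _; rewrite mule_ge0// lee_fin.
  - by apply: emeasurable_sum => k; apply: emeasurable_funM.
  pose L (y : n.-tuple rV * rV) : \bar R :=
    (enorm (s y - score (dens tau) y.2) ^+ 2 * dens tau y.2)%:E.
  apply: (measurable_fun_fubini_tonelli_F L).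
    apply/measurable_EFinP; apply: measurable_funM.
      under eq_fun do rewrite enorm_sqr /dotr.
      apply: measurable_sum => i.
      rewrite (_ : (fun y => _) = fun y : n.-tuple rV * rV =>
        (s y ord0 i - score (dens tau) y.2 ord0 i) ^+ 2).
        by apply: measurable_funX; exact: mdiff.
      by apply/funext => y /=; rewrite mxE [X in _ + X]mxE expr2.
    exact: (measurableT_comp (mdens tau) measurable_snd).
  by move=> y; rewrite lee_fin mulr_ge0 ?sqr_ge0// ltW.
Qed.

End risk.

End hypercube_family.

(** * The grid of bumps *)

Section grid.
Context {R : realType} {d m : nat}.
Hypotheses (d_gt0 : (0 < d)%N) (m_gt0 : (0 < m)%N).
Local Notation rV := ('rV[R]_d).
Local Notation I := {ffun 'I_d -> 'I_m}.
Local Notation C := 'I_d.+2.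

(** Position on a lattice [d.+2] times finer than the cells: bump [c] takes place [c] in every
    coordinate, so the bumps of a cell sit along its diagonal. The radius is half the spacing of
    this lattice. *)
Definition grid_index (j : I * C) (i : 'I_d) : nat := d.+2 * j.1 i + j.2.

Definition grid_center (j : I * C) : rV :=
  \row_i ((grid_index j i)%:R / (d.+2 * m)%:R).

Definition grid_radius : R := (2 * (d.+2 * m)%:R)^-1.

Let M_gt0 : 0 < (d.+2 * m)%:R :> R.
Proof. by rewrite ltr0n muln_gt0. Qed.

Lemma grid_radius_gt0 : 0 < grid_radius.
Proof. by rewrite invr_gt0 mulr_gt0. Qed.

Lemma grid_radius_le : grid_radius <= m%:R^-1 / 2.
Proof.
rewrite /grid_radius invfM mulrC ler_pM2r ?invr_gt0// lef_pV2 ?posrE ?ltr0n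
  ?muln_gt0//.
by rewrite ler_nat leq_pmull.
Qed.

Lemma grid_radius_le1 : grid_radius <= 1.
Proof.
apply: (le_trans grid_radius_le).
have : m%:R^-1 <= 1 :> R by rewrite invf_le1 ?ler1n ?ltr0n.
lra.
Qed.

(** Division by [d.+2]: the remainder in any one coordinate, available since [d] is positive, gives
    the bump, and the quotients give the cell. *)
Lemma grid_index_inj j j' : (forall i, grid_index j i = grid_index j' i) -> j = j'.
Proof.
case: j j' => [k c] [k' c'] E; rewrite /grid_index /= in E.
have cc : c = c'.
  have := E (Ordinal d_gt0); move=> /(congr1 (modn^~ d.+2)).
  by rewrite ![(d.+2 * _)%N]mulnC !modnMDl !modn_small// => /val_inj.
rewrite cc; congr pair; apply/ffunP => i; apply: val_inj => /=.
have := E i; rewrite cc => /addIn /eqP.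
by rewrite eqn_mul2l => /eqP.
Qed.

Lemma grid_center_bounds j i : 0 <= grid_center j ord0 i <= 1.
Proof.
rewrite mxE divr_ge0 ?ler0n//= ler_pdivrMr// mul1r ler_nat /grid_index.
have h1 := ltn_ord (j.1 i); have h2 := ltn_ord j.2.
apply: (@leq_trans (d.+2 * (j.1 i).+1)); last by rewrite leq_mul2l.
by rewrite mulnS addnC leq_add2r ltnW.
Qed.

(** If two caps are nonzero at [x], their centres differ in each coordinate by less than the lattice
    spacing, so the integer indices coincide. *)
Lemma grid_caps_disjoint (x : rV) :
  at_most_one (fun j => cap grid_radius (grid_center j) x).
Proof.
move=> j j' jj'.
have [->|/(cap_neq0 grid_radius_gt0) h] := eqVneq (cap grid_radius (grid_center
  j) x) 0.
  by left.
have [->|/(cap_neq0 grid_radius_gt0) h'] := eqVneq (cap grid_radius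
  (grid_center j') x) 0.
  by right.
exfalso; move/eqP: jj'; apply; apply: grid_index_inj => i.
have := le_lt_trans (coord_le_enorm _ i) h.
have := le_lt_trans (coord_le_enorm _ i) h'.
rewrite !mxE !ltr_norml => /andP[a1 a2] /andP[b1 b2].
have E : 2 * grid_radius = (d.+2 * m)%:R^-1.
  by rewrite /grid_radius invfM mulrA divff ?mul1r.
have : `|(grid_index j i)%:R - (grid_index j' i)%:R : R| < 1.
  have -> : (grid_index j i)%:R - (grid_index j' i)%:R = ((grid_index j i)%:R /
    (d.+2 * m)%:R
      - (grid_index j' i)%:R / (d.+2 * m)%:R) * (d.+2 * m)%:R :> R.
    by rewrite mulrBl !divfK ?gt_eqF.
  rewrite normrM [X in _ * X]ger0_norm ?ler0n// -ltr_pdivlMr// mul1r -[ltRHS]E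
    ltr_norml.
  move: a1 a2 b1 b2; move: (x ord0 i) (_ / _) (_ / _) grid_radius {E} => t u v q.
  by move=> *; apply/andP; split; lra.
move: (grid_index j i) (grid_index j' i) => u v.
wlog uv : u v / (u <= v)%N.
  move=> H; have [uv|/ltnW vu] := leqP u v; first exact: H.
  by rewrite distrC => /(H _ _ vu).
rewrite distrC -natrB// ger0_norm ?ler0n// (ltr_nat R _ 1) ltnS leqn0 subn_eq0.
by move=> vu; apply/eqP; rewrite eqn_leq uv.
Qed.

End grid.

(** * Choice of the constants and the minimax rate *)

Section minimax.
Context {R : realType} {d : nat}.
Local Notation rV := ('rV[R]_d).
Local Notation mu := (@lebesgue_row R d).

(** The first entry keeps the density between 1/2 and 3/2 of the Gaussian; with both, the factor
    [8 * e ^+ 2 * k * d.+2%:R] of the chi-square bound is at most 1/2. *)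
Definition amplitude (sigma : R) : R :=
  Num.min (1 / 2) (8 * gauss_peak (d := d) sigma * d.+2%:R)^-1.

Lemma amplitude_gt0 sigma : 0 < sigma -> 0 < amplitude sigma.
Proof.
move=> s0; rewrite lt_min divr_gt0//= invr_gt0 !mulr_gt0//.
exact: gauss_peak_gt0.
Qed.

Lemma amplitude_le sigma : amplitude sigma <= 1 / 2.
Proof. by rewrite ge_min lexx. Qed.

(** Both [r] and [2 * r] are at most [m%:R^-1], so the powers of the radius contribute at most
    [m ^- (d + 4)], hence at most [n%:R^-1]. *)
Lemma chi2_bound_le (sigma : R) (n m : nat) : (0 < d)%N -> 0 < sigma ->
  (0 < n)%N -> (0 < m)%N -> (n <= m ^ (d + 4))%N ->
  0 <= chi2_bound (d := d) (C := 'I_d.+2) sigma (@grid_radius R d m) (amplitude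
    sigma)
    <= (1 / 2) / n%:R.
Proof.
move=> d_gt0 s0 n0 m0 nm; rewrite /chi2_bound card_ord.
have r0 := grid_radius_gt0 (R := R) (d := d) m0.
have rm := grid_radius_le (R := R) (d := d) m0.
have e0 := amplitude_gt0 s0; have k0 := gauss_peak_gt0 (d := d) s0.
set r := grid_radius in r0 rm *; set e := amplitude sigma in e0 *.
set k := gauss_peak sigma in k0 *.
have D0 : 0 < d.+2%:R :> R by rewrite ltr0n.
have mi0 : 0 < m%:R^-1 :> R by rewrite invr_gt0 ltr0n.
have ek : 8 * e ^+ 2 * k * d.+2%:R <= 1 / 2.
  have h1 : e <= 1 / 2 := amplitude_le sigma.
  have h2 : e * (8 * k * d.+2%:R) <= 1.
    by rewrite -ler_pdivlMr ?mulr_gt0// div1r /e /amplitude ge_min lexx orbT.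
  have h3 : 0 <= e * (8 * k * d.+2%:R) by rewrite !mulr_ge0 ?ltW.
  have : (e * (8 * k * d.+2%:R)) * e <= 1 * (1 / 2) by rewrite ler_pM// ltW.
  lra.
have rr : r ^+ 4 * (2 * r) ^+ d <= n%:R^-1.
  apply: (@le_trans _ _ (m%:R^-1 ^+ 4 * m%:R^-1 ^+ d)).
    have r2 : 2 * r <= m%:R^-1 by lra.
    have r1 : r <= m%:R^-1 by lra.
    apply: ler_pM; rewrite ?exprn_ge0 ?mulr_ge0 ?(ltW r0)//.
      by rewrite lerXn2r ?nnegrE ?(ltW r0) ?(ltW mi0).
    by rewrite lerXn2r ?nnegrE ?mulr_ge0 ?(ltW r0) ?(ltW mi0).
  rewrite -exprD addnC exprVn lef_pV2 ?posrE ?exprn_gt0 ?ltr0n//.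
  by rewrite -natrX ler_nat.
have rr0 : 0 <= r ^+ 4 * (2 * r) ^+ d.
  by rewrite mulr_ge0 ?exprn_ge0 ?mulr_ge0 ?ltW.
have -> : 8 * e ^+ 2 * r ^+ 4 * k * d.+2%:R * (2 * r) ^+ d =
    (8 * e ^+ 2 * k * d.+2%:R) * (r ^+ 4 * (2 * r) ^+ d) by ring.
have ek0 : 0 <= 8 * e ^+ 2 * k * d.+2%:R.
  by rewrite mulr_ge0 ?ler0n// mulr_ge0 ?(ltW k0)// mulr_ge0 ?sqr_ge0.
by rewrite mulr_ge0//= ler_pM.
Qed.

(** A quarter of the coefficient of [m%:R ^- 2] in [risk_lower_bound]: the [m ^ d] cells cancel
    against the volume of a box, and [r ^+ 2] supplies [m%:R ^- 2]. The quarter is the loss in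
    [root_approximation]. *)
Definition rate_cst (sigma : R) : R :=
  dens_lower_bound (d := d) sigma * amplitude sigma ^+ 2 / (128 * d%:R ^+ 2 *
    d.+2%:R ^+ 2)
  * (8 * d%:R * d.+2%:R)^-1 ^+ d.

Lemma minimax_grid_bound (alpha sigma : R) (n m : nat) : (0 < d)%N -> 0 < sigma ->
  2 * sigma ^+ 2 = alpha ^+ 2 ->
  (0 < n)%N -> (0 < m)%N -> (n <= m ^ (d + 4))%N ->
  ((4 * rate_cst sigma * m%:R ^- 2)%:E <=
    @minimax_score_risk R d alpha (lipschitz_cst (d := d) sigma) n)%E.
Proof.
move=> d_gt0 s0 sa n0 m0 nm.
pose I := {ffun 'I_d -> 'I_m}; pose C := 'I_d.+2.
pose z : I * C -> rV := grid_center; pose r : R := @grid_radius R d m.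
pose e := amplitude sigma.
have r0 : 0 < r := grid_radius_gt0 m0; have r1 : r <= 1 := grid_radius_le1 m0.
have e0 : 0 < e := amplitude_gt0 s0; have e1 : e <= 1 / 2 := amplitude_le sigma.
(* Index [ord0] encodes the mass and [lift ord0 i] the [i]-th coordinate: [d.+1] conditions on
   [d.+2] coefficients. *)
pose moment k (c : C) (l : 'I_d.+1) : R :=
  if unlift ord0 l is Some i
  then \int[mu]_x (gauss sigma x * x ord0 i * cap r (z (k, c)) x ^+ 2)
  else \int[mu]_x (gauss sigma x * 1 * cap r (z (k, c)) x ^+ 2).
have /choice[p pP] := fun k => bounded_kernel_vector (moment k).
have p1 k c : `|p k c| <= 1 by have [h _ _] := pP k.
have /choice[c0 pc0] : forall k, exists c, p k c = 1 by move=> k;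
  have [_ h _] := pP k.
have mass k : \sum_c p k c *
    \int[mu]_x (gauss sigma x * 1 * cap r (z (k, c)) x ^+ 2) = 0.
  have [_ _ /(_ ord0)] := pP k; rewrite /moment unlift_none; exact.
have mean k i : \sum_c p k c *
    \int[mu]_x (gauss sigma x * x ord0 i * cap r (z (k, c)) x ^+ 2) = 0.
  have [_ _ /(_ (lift ord0 i))] := pP k; rewrite /moment liftK; exact.
have disj := @grid_caps_disjoint R d m d_gt0 m0.
pose dens (tau : {ffun I -> bool}) := pert_density sigma r e z (weight p tau).
have wmass tau := weight_moment
  (h := fun j => \int[mu]_x (gauss sigma x * 1 * cap r (z j) x ^+ 2)) tau mass.
have wmean tau i := weight_moment
  (h := fun j => \int[mu]_x (gauss sigma x * x ord0 i * cap r (z j) x ^+ 2))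
  tau (mean ^~ i).
have w1 tau := weight_le1 p1 tau.
have /choice[P PE] : forall tau, exists P : probability rV R, forall A,
  measurable A ->
    P A = (\int[mu]_(x in A) (dens tau x)%:E)%E.
  move=> tau; apply: probability_of_density.
  - exact: measurable_pert_density.
  - by move=> x; exact: ltW (pert_density_gt0 s0 r0 r1 e0 e1 (w1 tau) disj x).
  - exact: (integral_pert_density e s0 (wmass tau)).
have inclass tau : score_class alpha (lipschitz_cst (d := d) sigma) (P tau)
  (dens tau).
  exact: (pert_score_class s0 r0 r1 e0 e1 (w1 tau) disj (wmass tau) (wmean tau)
    sa (PE tau)).
apply: le_ereal_inf_tmp => _ [s ms <-].
have /andP[chi0 chi1] := chi2_bound_le d_gt0 s0 n0 m0 nm.
have chi2 := exp1Dinv_le2 n0 chi0 chi1.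
have D0 : d.+2%:R != 0 :> R by rewrite pnatr_eq0.
have dR0 : d%:R != 0 :> R by rewrite pnatr_eq0 -lt0n.
have mR0 : m%:R != 0 :> R by rewrite pnatr_eq0 -lt0n.
apply: (le_trans _ (risk_lower_bound s0 r0 r1 e0 e1 p1 pc0 disj
  (@grid_center_bounds R d m m0) mass d_gt0 PE ms chi2 _)); last first.
  move=> tau; apply: ereal_sup_ubound; exists (P tau, dens tau) => //.
  exact: inclass.
rewrite lee_fin card_ffun !card_ord natrX /separation /rate_cst -/e le_eqVlt.
apply/orP; left; apply/eqP.
have -> : (8 * d%:R * d.+2%:R)^-1 ^+ d = m%:R ^+ d * (r / (4 * d%:R)) ^+ d.
  rewrite -exprMn; congr (_ ^+ _); rewrite /r /grid_radius natrM.
  move: (d.+2%:R : R) (d%:R : R) (m%:R : R) D0 dR0 mR0 => x y w x0 y0 w0.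
  by field; rewrite x0 y0 w0.
have -> : r ^+ 2 = (4 * d.+2%:R ^+ 2)^-1 * m%:R ^- 2.
  rewrite /r /grid_radius natrM.
  move: (d.+2%:R : R) (m%:R : R) D0 mR0 => x w x0 w0.
  by field; rewrite x0 w0.
move: (m%:R ^+ d : R) ((r / (4 * d%:R)) ^+ d : R) (dens_lower_bound (d := d)
  sigma) => x y w.
move: (d.+2%:R : R) (d%:R : R) (m%:R : R) D0 dR0 mR0 => D t q D0 t0 q0.
by field; rewrite D0 t0 q0.
Qed.

Lemma rate_cst_gt0 sigma : (0 < d)%N -> 0 < sigma -> 0 < rate_cst sigma.
Proof.
move=> d_gt0 s0.
have D0 : 0 < d.+2%:R :> R by rewrite ltr0n.
have dR0 : 0 < d%:R :> R by rewrite ltr0n.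
have w0 : 0 < dens_lower_bound (d := d) sigma.
  by rewrite divr_gt0// mulr_gt0 ?gauss_peak_gt0 ?expR_gt0.
apply: mulr_gt0; last by rewrite exprn_gt0// invr_gt0 !mulr_gt0.
apply: divr_gt0; last by rewrite !mulr_gt0.
by rewrite mulr_gt0// exprn_gt0// amplitude_gt0.
Qed.

End minimax.

Theorem theorem3 (R : realType) (d : nat) (alpha : R)
  (d_gt0 : (0 < d)%N) (alpha_gt0 : 0 < alpha) :
  exists c L : R, [/\ 0 < c, 1 <= alpha ^+ 2 * L &
    forall n : nat, (0 < n)%N ->
      ((c * n%:R `^ (- (2 / (d + 4)%:R)))%:E <=
        @minimax_score_risk R d alpha L n)%E].
Proof.
pose sigma := alpha / Num.sqrt 2.
have s2 : 2 * sigma ^+ 2 = alpha ^+ 2.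
  by rewrite expr_div_n sqr_sqrtr// mulrCA divff// mulr1.
have s0 : 0 < sigma by rewrite divr_gt0// sqrtr_gt0.
exists (rate_cst (d := d) sigma), (lipschitz_cst (d := d) sigma); split.
- exact: rate_cst_gt0.
- have d1 : 1 <= Num.sqrt d%:R :> R.
    by rewrite -[leLHS]sqrtr1 ler_wsqrtr// ler1n.
  have a2 : 0 <= alpha ^+ 2 by exact: sqr_ge0.
  (* The Gaussian part of the Lipschitz constant alone makes [alpha ^+ 2 * L] at least 2. *)
  have E : alpha ^+ 2 * (sigma ^+ 2)^-1 = 2.
    by rewrite -s2 mulfK// sqrf_eq0 gt_eqF.
  have h : 1 <= alpha ^+ 2 * ((sigma ^+ 2)^-1 + 104) by rewrite mulrDr E; lra.
  rewrite /lipschitz_cst mulrCA.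
  by rewrite -[leLHS]mulr1 ler_pM.
- move=> n n0.
  have [m [m0 nm hm]] := root_approximation R n0 (ltn_addl d (isT : 0 < 4)%N).
  apply: le_trans (minimax_grid_bound d_gt0 s0 s2 n0 m0 nm).
  rewrite lee_fin; have c0 := rate_cst_gt0 d_gt0 s0.
  by rewrite -(ler_pM2l c0) in hm; lra.
Qed.
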